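(* Let $\omega$ be any symplectic form on the sphere $\mathbb{S}^2$. The Poisson structure of $\omega$ cannot be induced by a classical $r$-matrix: there do not exist a finite-dimensional real Lie algebra $\mathfrak{g}$, a Lie algebra action $\phi\colon\mathfrak{g}\to\Gamma^\infty(T\mathbb{S}^2)$ and an $r$-matrix $r\in\mathfrak{g}\wedge\mathfrak{g}$ such that the Poisson bivector of $\omega$ is the one induced by $r$ via $\phi$.
   Context: $r$-matrix: an element $r\in\mathfrak{g}\wedge\mathfrak{g}$ with $[\![r,r]\!]=0$, where $[\![\cdot,\cdot]\!]$ is the Gerstenhaber bracket on $\Lambda^\bullet\mathfrak{g}$ extending the Lie bracket. A Lie algebra action of $\mathfrak{g}$ on a manifold $M$ is a Lie algebra homomorphism $\phi\colon\mathfrak{g}\to\Gamma^\infty(TM)$. Given a basis $e_1,\dots,e_n$ of $\mathfrak{g}$ and $r=\frac12\sum_{i,j}r^{ij}e_i\wedge e_j$, the Poisson bivector induced by $r$ via $\phi$ is $\pi=\frac12\sum_{i,j}r^{ij}\phi(e_i)\wedge\phi(e_j)$. *)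

(* Defs.v *)
From HB Require Import structures.
From mathcomp Require Import all_boot all_order all_algebra.
From mathcomp Require Import all_classical all_reals all_analysis.

Set Implicit Arguments.
Unset Strict Implicit.
Unset Printing Implicit Defensive.

Import Order.TTheory GRing.Theory Num.Theory.
Import numFieldNormedType.Exports.

Local Open Scope classical_set_scope.
Local Open Scope ring_scope.

Record lie_algebra (R : realType) := LieAlgebra {
  lie_carrier :> vectType R ;
  lie_br : lie_carrier -> lie_carrier -> lie_carrier ;
  lie_br_linearl : forall y, linear (lie_br ^~ y) ;
  lie_br_linearr : forall x, linear (lie_br x) ;
  lie_br_alt : forall x, lie_br x x = 0 ;
  lie_br_jacobi : forall x y z,
    lie_br x (lie_br y z) + lie_br y (lie_br z x) + lie_br z (lie_br x y) = 0 }.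

(* Multivectors of degree k are represented by the alternating k-linear maps
   they define on covectors, with
   (x_1 /\ ... /\ x_k)(a_1, ..., a_k) = det (a_j (x_i)).  The covectors are
   bare functions so that the same formula serves for covectors that are only
   defined on a tangent plane of the sphere. *)
Definition wedge (R : realType) (V : lmodType R) (x : seq V)
    (a : seq (V -> R)) : R :=
  \det (\matrix_(i < size x, j < size x) nth (fun=> 0) a j (nth 0 x i)).

(* The multivector 1/2 \sum_(i, j) r^{ij} x_i /\ x_j. *)
Definition bivector (R : realType) (V : lmodType R) (n : nat) (r : 'M[R]_n)
    (x : 'I_n -> V) (a b : V -> R) : R :=
  2^-1 * \sum_(i < n) \sum_(j < n) r i j * wedge [:: x i; x j] [:: a; b].

(* The value on decomposable elements of the Gerstenhaber bracket, forced by
   the graded Leibniz rule: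
   [[x_1 /\ ... /\ x_p, y_1 /\ ... /\ y_q]] is the sum over i, j of
   (-1)^(i+j) [x_i, y_j] /\ x_1 ..^i.. x_p /\ y_1 ..^j.. y_q,
   the i-th x and the j-th y being omitted. *)
Definition gerstenhaber (R : realType) (g : lie_algebra R) (x y : seq g)
    (a : seq (g -> R)) : R :=
  \sum_(i < size x) \sum_(j < size y) (-1) ^+ (i + j) *
    wedge (lie_br (nth 0 x i) (nth 0 y j) ::
           (take i x ++ drop i.+1 x) ++ (take j y ++ drop j.+1 y)) a.

(* [[r, r]] = 0 for r = 1/2 \sum_(i, j) r^{ij} e_i /\ e_j, the bracket being
   expanded by bilinearity. *)
Definition r_matrix (R : realType) (g : lie_algebra R) (n : nat)
    (e : 'I_n -> g) (r : 'M[R]_n) : Prop :=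
  r^T = - r /\
  forall a b c : {scalar g},
    2^-1 * 2^-1 * \sum_(i < n) \sum_(j < n) \sum_(k < n) \sum_(l < n)
      r i j * r k l *
      gerstenhaber [:: e i; e j] [:: e k; e l]
        [:: (a : g -> R); (b : g -> R); (c : g -> R)] = 0.

(* Scalar functions, vector fields and 2-forms on S^2 are functions on R^3 of
   which only the values on S^2 (and on tangent vectors) are meaningful;
   accordingly all identities between them are required on S^2 only. *)

(* The library norm on 'rV[R]_3 is the supremum norm. *)
Definition dot (R : realType) (u v : 'rV[R]_3) : R :=
  \sum_(i < 3) u 0 i * v 0 i.

Definition sphere (R : realType) : set 'rV[R]_3 := [set p | dot p p = 1].

Definition tangent (R : realType) (p : 'rV[R]_3) : set 'rV[R]_3 :=
  [set v | dot p v = 0].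

Fixpoint Ck (R : realType) (V W : normedModType R) (k : nat) (U : set V)
    (f : V -> W) : Prop :=
  match k with
  | 0 => forall x, U x -> {for x, continuous f}
  | k'.+1 => (forall x, U x -> differentiable f x) /\
             (forall v, Ck k' U (fun x => 'D_v f x))
  end.

(* Smoothness of a map on the subset S^2 of R^3: local smooth extensions to
   open subsets of R^3. *)
Definition smooth_on_sphere (R : realType) (W : normedModType R)
    (f : 'rV[R]_3 -> W) : Prop :=
  forall p, sphere p -> exists (U : set 'rV[R]_3) (F : 'rV[R]_3 -> W),
    [/\ open U, U p, forall k, Ck k U F
      & forall q, U q -> sphere q -> F q = f q].

Definition radial (R : realType) (x : 'rV[R]_3) : 'rV[R]_3 :=
  (Num.sqrt (dot x x))^-1 *: x.

(* The derivative of f at p in S^2 along a tangent vector v, that is the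
   derivative at t = 0 of f along the curve t |-> radial (p + t v) of S^2,
   which starts at p with velocity v. *)
Definition sphere_derive (R : realType) (W : normedModType R)
    (f : 'rV[R]_3 -> W) (p v : 'rV[R]_3) : W :=
  'D_v (fun x => f (radial x)) p.

Definition vector_field (R : realType) (X : 'rV[R]_3 -> 'rV[R]_3) : Prop :=
  (forall p, sphere p -> tangent p (X p)) /\ smooth_on_sphere X.

(* The field acting on functions by f |-> X (Y f) - Y (X f), computed on the
   coordinate functions of R^3. *)
Definition field_bracket (R : realType) (X Y : 'rV[R]_3 -> 'rV[R]_3)
    (p : 'rV[R]_3) : 'rV[R]_3 :=
  sphere_derive Y p (X p) - sphere_derive X p (Y p).

Definition lie_action (R : realType) (g : lie_algebra R)
    (phi : g -> 'rV[R]_3 -> 'rV[R]_3) : Prop :=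
  [/\ forall x, vector_field (phi x),
      forall (a : R) x y p, sphere p ->
        phi (a *: x + y) p = a *: phi x p + phi y p
    & forall x y p, sphere p ->
        phi (lie_br x y) p = field_bracket (phi x) (phi y) p].

Definition two_form (R : realType)
    (w : 'rV[R]_3 -> 'rV[R]_3 -> 'rV[R]_3 -> R) : Prop :=
  [/\ forall p (a : R) u u' v, sphere p ->
        tangent p u -> tangent p u' -> tangent p v ->
        w p (a *: u + u') v = a * w p u v + w p u' v,
      forall p u v, sphere p -> tangent p u -> tangent p v ->
        w p u v = - w p v u
    & forall X Y, vector_field X -> vector_field Y ->
        smooth_on_sphere (W := R) (fun p => w p (X p) (Y p))].

(* The exterior derivative, by Cartan's formula. *)
Definition ext_derive (R : realType)
    (w : 'rV[R]_3 -> 'rV[R]_3 -> 'rV[R]_3 -> R)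
    (X Y Z : 'rV[R]_3 -> 'rV[R]_3) (p : 'rV[R]_3) : R :=
  sphere_derive (W := R) (fun q => w q (Y q) (Z q)) p (X p)
  + sphere_derive (W := R) (fun q => w q (Z q) (X q)) p (Y p)
  + sphere_derive (W := R) (fun q => w q (X q) (Y q)) p (Z p)
  - w p (field_bracket X Y p) (Z p)
  - w p (field_bracket Y Z p) (X p)
  - w p (field_bracket Z X p) (Y p).

Definition symplectic_form (R : realType)
    (w : 'rV[R]_3 -> 'rV[R]_3 -> 'rV[R]_3 -> R) : Prop :=
  [/\ two_form w,
      forall X Y Z, vector_field X -> vector_field Y -> vector_field Z ->
        forall p, sphere p -> ext_derive w X Y Z p = 0
    & forall p u, sphere p -> tangent p u ->
        (forall v, tangent p v -> w p u v = 0) -> u = 0].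

(* pi p a b is the value at p of the bivector pi on two covectors a, b of the
   tangent plane at p.  With the Hamiltonian field of f defined by
   w(X_f, -) = df, this says pi(df, dh) = w(X_f, X_h) = {f, h}; it determines
   pi since every covector is of the form w p u when w is nondegenerate. *)
Definition poisson_bivector_of (R : realType)
    (w : 'rV[R]_3 -> 'rV[R]_3 -> 'rV[R]_3 -> R)
    (pi : 'rV[R]_3 -> ('rV[R]_3 -> R) -> ('rV[R]_3 -> R) -> R) : Prop :=
  forall p u v, sphere p -> tangent p u -> tangent p v ->
    pi p (w p u) (w p v) = w p u v.

Definition induced_bivector (R : realType) (g : lie_algebra R)
    (phi : g -> 'rV[R]_3 -> 'rV[R]_3) (n : nat) (e : 'I_n -> g) (r : 'M[R]_n)
    (p : 'rV[R]_3) : ('rV[R]_3 -> R) -> ('rV[R]_3 -> R) -> R :=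
  bivector r (fun i => phi (e i) p).

(* Main.v *)
Require Import Defs.
From HB Require Import structures.
From mathcomp Require Import all_boot all_order all_algebra.
From mathcomp Require Import all_classical all_reals all_analysis.
From mathcomp Require Import ring lra.
Import Order.TTheory GRing.Theory Num.Theory.
Import numFieldNormedType.Exports.
Local Open Scope classical_set_scope.
Local Open Scope ring_scope.

(** Suppose that the Poisson bivector of w is induced by r through phi.  Write
    b_u for the functional x |-> w(u, phi(x)) on g attached to a tangent vector
    u, and c(u) for its image under the map g^* -> g defined by r.  That w and
    the induced bivector are inverse to each other means that phi(c(u)) = u
    ([contr_pairing]): the g-valued one-form c splits the infinitesimal action.

    Two structure equations hold on the sphere.  The functional-valued one-form
    b satisfies
      db(u, v) = b_v([c(u), -]) - b_u([c(v), -])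
    ([pairing_structure_eq]); in dimension 2 it says that the action changes w
    by the factor dictated by its effect on the inverse bivector.  Together
    with the classical Yang-Baxter equation ([yang_baxter]) it implies the
    Maurer-Cartan equation dc(u, v) = - [c(u), c(v)]
    ([sharp_coadjoint_bracket]).  Hence the linear system
      dy = - [c, y],     d eta = w(-, phi(y))
    for y : S^2 -> g and eta : S^2 -> R has zero curvature ([conn_flat],
    [curvature]), and since the sphere is simply connected it has a global
    solution with any prescribed value of y at one point
    ([parallel_sections]).

    Let y be a solution with phi(y) <> 0 at the initial point.  The field
    Z = phi(y) satisfies a homogeneous linear differential equation along every
    curve ([parallel_field_eq]), so it vanishes nowhere.  But eta has a maximum
    on the compact sphere, where 0 = d eta = w(-, Z) forces Z = 0.  This is the
    contradiction ([symplectic_not_induced]).  On the torus,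
    whose invariant symplectic form is induced by an abelian Lie algebra, eta
    is only multivalued.

    Simple connectedness enters through spherical coordinates.  All meridians
    leave from one pole, with the same initial value; the system is solved
    along each of them as an ordinary differential equation ([linear_ode]), and
    zero curvature makes the result a solution in the direction of the
    parallels as well ([flat_transport]).  The other pole needs no gluing: the
    solution is constant along the segment of coordinates representing it.

    Functions on the sphere are composed with the radial projection, which
    makes them continuously differentiable on the complement of the origin
    ([smooth_Ck1]), and w is a multiple, with a smooth factor, of the area form
    u, v |-> det(p, u, v) ([two_form_area]). *)

(** * One-variable calculus *)

Section Calculus.
Context {R : realType}.
Implicit Types (a b t : R) (f g : R -> R).

Lemma is_derive_lamD {V : normedModType R} {f g : V -> R} {x v : V} {df dg : R} :
  is_derive x v f df -> is_derive x v g dg ->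
  is_derive x v (fun y => f y + g y) (df + dg).
Proof. by move=> hf hg; exact: is_deriveD. Qed.

Lemma is_derive_lamB {V : normedModType R} {f g : V -> R} {x v : V} {df dg : R} :
  is_derive x v f df -> is_derive x v g dg ->
  is_derive x v (fun y => f y - g y) (df - dg).
Proof. by move=> hf hg; exact: is_deriveB. Qed.

Lemma is_derive_lamM {V : normedModType R} {f g : V -> R} {x v : V} {df dg : R} :
  is_derive x v f df -> is_derive x v g dg ->
  is_derive x v (fun y => f y * g y) (df * g x + f x * dg).
Proof.
move=> hf hg; have h : is_derive x v (f * g) (f x *: dg + g x *: df).
  exact: is_deriveM.
by apply: (is_derive_eq h); rewrite /GRing.scale /= addrC [g x * _]mulrC.
Qed.

Lemma is_derive_lam_sum {V : normedModType R} n (f : 'I_n -> V -> R) (x v : V)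
    (df : 'I_n -> R) :
  (forall i, is_derive x v (f i) (df i)) ->
  is_derive x v (fun y => \sum_(i < n) f i y) (\sum_(i < n) df i).
Proof.
move=> hf; have -> : (fun y => \sum_(i < n) f i y) = \sum_(i < n) f i.
  by apply/funext => y; rewrite fct_sumE.
exact: is_derive_sum.
Qed.

Lemma continuous_lam_sum {T : topologicalType} {W : normedModType R} n
    (f : 'I_n -> T -> W) (x : T) :
  (forall i, {for x, continuous (f i)}) ->
  {for x, continuous (fun y => \sum_(i < n) f i y)}.
Proof.
elim: n f => [|n IHn] f hf.
  rewrite (_ : (fun _ => _) = cst 0); first exact: cvg_cst.
  by apply/funext => y; rewrite big_ord0.
rewrite (_ : (fun _ => _) =
  (fun y => f ord0 y + \sum_(i < n) f (lift ord0 i) y)); last first.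
  by apply/funext => y; rewrite big_ord_recl.
apply: (@continuousD _ _ _ (f ord0)); first exact: hf.
by apply: IHn => i; exact: hf.
Qed.

Lemma derive_ge0_le {f} {df : R -> R} {a b} : a <= b ->
  (forall x, x \in `]a, b[ -> is_derive x 1 f (df x)) ->
  {within `[a, b], continuous f} ->
  (forall x, x \in `]a, b[ -> 0 <= df x) -> f a <= f b.
Proof.
rewrite le_eqVlt => /predU1P[-> //|ab] hf cf df0.
have [c cab] := MVT ab hf cf; rewrite -subr_ge0 => ->.
by rewrite mulr_ge0 ?subr_ge0 ?(ltW ab) ?df0.
Qed.

Lemma within_subitv {f a b a' b'} : a <= a' -> b' <= b ->
  {within `[a, b], continuous f} -> {within `[a', b'], continuous f}.
Proof.
move=> aa bb; apply: continuous_subspaceW; apply: subset_itv;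
  by rewrite bnd_simp.
Qed.

Lemma within_continuous_lam_sum a b n (f : 'I_n -> R -> R) :
  (forall i, {within `[a, b], continuous (f i)}) ->
  {within `[a, b], continuous (fun y => \sum_(i < n) f i y)}.
Proof. by move=> hf x; apply: continuous_lam_sum => i; exact: hf. Qed.

Lemma within_continuous_lamM a b f g :
  {within `[a, b], continuous f} -> {within `[a, b], continuous g} ->
  {within `[a, b], continuous (fun y => f y * g y)}.
Proof.
move=> hf hg x; apply: (@continuousM R (subspace `[a, b]) f g x);
  [exact: hf | exact: hg].
Qed.

Lemma derive_le {f g} {df dg : R -> R} {a b} :
  (forall x, x \in `]a, b[ -> is_derive x 1 f (df x)) ->
  (forall x, x \in `]a, b[ -> is_derive x 1 g (dg x)) ->
  {within `[a, b], continuous f} -> {within `[a, b], continuous g} ->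
  (forall x, x \in `]a, b[ -> df x <= dg x) ->
  forall t, t \in `[a, b] -> f t - f a <= g t - g a.
Proof.
move=> hf hg cf cg le t; rewrite in_itv /= => /andP[at_ tb].
have sub x : x \in `]a, t[ -> x \in `]a, b[.
  by rewrite !in_itv /= => /andP[-> xt]; rewrite (lt_le_trans xt tb).
suff : g a - f a <= g t - f t by lra.
have hfg x : x \in `]a, t[ -> is_derive x 1 (fun x => g x - f x) (dg x - df x).
  by move=> /sub xab; apply: is_derive_lamB; [exact: hg | exact: hf].
have cfg : {within `[a, t], continuous (fun x => g x - f x)}.
  by apply: (@within_continuousB _ _ _ _ g f);
    exact: (within_subitv (lexx a) tb).
apply: (derive_ge0_le at_ hfg cfg).
by move=> x /sub /le; rewrite subr_ge0.
Qed.

Lemma derive_norm_le {f g} {df dg : R -> R} {a b} :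
  (forall x, x \in `]a, b[ -> is_derive x 1 f (df x)) ->
  (forall x, x \in `]a, b[ -> is_derive x 1 g (dg x)) ->
  {within `[a, b], continuous f} -> {within `[a, b], continuous g} ->
  (forall x, x \in `]a, b[ -> `|df x| <= dg x) ->
  forall t, t \in `[a, b] -> `|f t - f a| <= g t - g a.
Proof.
move=> hf hg cf cg le t tab.
have up : f t - f a <= g t - g a.
  apply: (derive_le hf hg cf cg) => // x /le; exact: ler_normlW.
have hN x : x \in `]a, b[ -> is_derive x 1 (fun x => - f x) (- df x).
  by move=> xab; apply: is_deriveN; exact: hf.
have cN : {within `[a, b], continuous (fun x => - f x)}.
  by move=> x; apply: (@continuousN _ _ (subspace `[a, b])); exact: cf.
have lo : - f t - - f a <= g t - g a.
  apply: (derive_le hN hg cN cg) => // x /le.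
  by rewrite ler_norml => /andP[h _]; rewrite lerNl.
by rewrite ler_norml; lra.
Qed.

Lemma derive_norm_le_cst {f} {df : R -> R} {C a b} : a <= b ->
  (forall x, x \in `]a, b[ -> is_derive x 1 f (df x)) ->
  {within `[a, b], continuous f} ->
  (forall x, x \in `]a, b[ -> `|df x| <= C) ->
  `|f b - f a| <= C * (b - a).
Proof.
move=> ab hf cf le; rewrite mulrBr.
have hg x : x \in `]a, b[ -> is_derive x 1 (fun x => C * x) C.
  move=> _; have h := is_derive_lamM (is_derive_cst C x 1) (is_derive_id x 1).
  by apply: (is_derive_eq h); rewrite mul0r add0r mulr1.
have cg : {within `[a, b], continuous (fun x => C * x)}.
  by apply: continuous_subspaceT => x; apply: continuousM; [exact: cst_continuous | exact: cvg_id].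
by apply: (derive_norm_le hf hg cf cg) => //; rewrite in_itv /= ab lexx.
Qed.

(** Differentiability is two-sided inside the interval and only continuity is
    kept at its ends, so that the construction can be iterated. *)
Lemma antiderivative {f a b} : a < b -> {within `[a, b], continuous f} ->
  exists F : R -> R, [/\ F a = 0, {within `[a, b], continuous F}
    & forall t, t \in `]a, b[ -> is_derive t 1 F (f t)].
Proof.
move=> ab cf.
pose mu := @lebesgue_measure R.
have fi : mu.-integrable `[a, b] (EFin \o f).
  by apply: continuous_compact_integrable => //; exact: segment_compact.
exists (fun x => parameterized_integral mu a x f); split.
- by rewrite /parameterized_integral set_itv1 Rintegral_set1.
- exact: (parameterized_integral_continuous (ltW ab) fi).
- move=> t tab; have := tab; rewrite in_itv /= => /andP[at_ tb].
  have ct : {for t, continuous f}.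
    move: cf => /(continuous_within_itvP _ ab)[+ _ _]; apply.
    by rewrite inE /=.
  have [d e] := continuous_FTC1_closed tb fi at_ ct.
  by apply: DeriveDef; [exact: d | rewrite -derive1E; exact: e].
Qed.

Lemma continuous_bounded f a b : {within `[a, b], continuous f} ->
  exists2 M, 0 <= M & forall t, t \in `[a, b] -> `|f t| <= M.
Proof.
move=> cf; have := continuous_compact cf (@segment_compact _ a b).
move=> /compact_bounded[M [_ hM]]; exists (`|M| + 1); first by rewrite addr_ge0.
move=> t tab; apply: (hM (`|M| + 1)).
  by rewrite (le_lt_trans (ler_norm _)) // ltrDl.
by exists t.
Qed.

End Calculus.

Section OneSided.
Context {R : realType}.

Lemma derive_right_max (f : R -> R) (d del : R) :
  is_derive (0 : R) 1 f d -> 0 < del -> (forall h, 0 < h < del -> f h <= f 0) -> d <= 0.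
Proof.
move=> [df fd] del0 H; rewrite leNgt; apply/negP => d0.
have c : (fun h => h^-1 *: ((f \o shift 0) (h *: 1) - f 0)) @ 0^' --> d.
  by rewrite -fd; exact: df.
have [eps /= eps0 Heps] := cvgr_gt d c 0 d0.
pose h := Num.min eps del / 2.
have m0 : 0 < Num.min eps del by rewrite lt_min eps0.
have h0 : 0 < h by rewrite divr_gt0.
have hm : h < Num.min eps del by rewrite ltr_pdivrMr // ltr_pMr // ltr1n.
have := Heps h _ (lt0r_neq0 h0).
rewrite /ball /= sub0r normrN gtr0_norm // (lt_le_trans hm) ?ge_min ?lexx //.
move=> /(_ isT); rewrite addr0 /GRing.scale /= mulr1 pmulr_rgt0 ?invr_gt0 // subr_gt0.
by rewrite ltNge H // h0 (lt_le_trans hm) // ge_min lexx orbT.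
Qed.

(** One-sided Fermat rule; sg = 1 and sg = -1 are the two sides of c. *)
Lemma derive_side_max (f : R -> R) (c d sg del : R) :
  is_derive c 1 f d -> 0 < del ->
  (forall h, 0 < h < del -> f (c + sg * h) <= f c) -> sg * d <= 0.
Proof.
move=> hf del0 H.
have hg : is_derive (0 : R) 1 (fun h : R => c + sg * h) sg.
  have h1 := is_derive_lamM (is_derive_cst sg (0 : R) 1) (is_derive_id (0 : R) 1).
  have h2 := is_derive_lamD (is_derive_cst c (0 : R) 1) h1.
  by apply: (is_derive_eq h2); rewrite mul0r !add0r mulr1.
have hf' : is_derive (c + sg * 0) 1 f d by rewrite mulr0 addr0.
have := @is_derive1_comp R f (fun h => c + sg * h) 0 d sg hf' hg; rewrite mulrC => /derive_right_max /(_ del0); apply.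
by move=> h hh /=; rewrite mulr0 addr0 H.
Qed.
End OneSided.

(** * Linear ordinary differential equations *)

Section LinearODE.
Context {R : realType}.
Implicit Types (a b t : R) (f g : R -> R).

Lemma is_derive_expR_affine (K a t : R) :
  is_derive t 1 (fun x => expR (K * (x - a))) (K * expR (K * (t - a))).
Proof.
have h : is_derive t 1 (fun x : R => K * (x - a)) K.
  have h0 : is_derive t 1 (fun x : R => x - a) (1 - 0).
    exact: is_derive_lamB.
  have h1 := is_derive_lamM (is_derive_cst K t 1) h0.
  by apply: (is_derive_eq h1); rewrite mul0r add0r subr0 mulr1.
by rewrite mulrC; exact: is_derive1_comp.
Qed.

Lemma continuous_expR_affine (K a : R) : continuous (fun x => expR (K * (x - a))).
Proof.
move=> t; apply/differentiable_continuous/derivable1_diffP.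
by have [] := is_derive_expR_affine K a t.
Qed.

(** The function u e^(-K(t - a)) has derivative at most C. *)
Lemma gronwall (u du : R -> R) (K C a b : R) : 0 <= K -> 0 <= C ->
  (forall t, t \in `]a, b[ -> is_derive t 1 u (du t)) ->
  {within `[a, b], continuous u} ->
  (forall t, t \in `]a, b[ -> du t <= K * u t + C) ->
  forall t, t \in `[a, b] -> u t <= (u a + C * (t - a)) * expR (K * (t - a)).
Proof.
move=> K0 C0 hu cu le t tab.
have := tab; rewrite in_itv /= => /andP[at_ tb].
pose f x := u x * expR (- K * (x - a)).
have hf x : x \in `]a, b[ ->
    is_derive x 1 f (du x * expR (- K * (x - a)) +
                     u x * (- K * expR (- K * (x - a)))).
  move=> /hu hx; apply: is_derive_lamM => //; exact: is_derive_expR_affine.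
have hg x : x \in `]a, b[ -> is_derive x 1 (fun x => C * x) C.
  move=> _; have h := is_derive_lamM (is_derive_cst C x 1) (is_derive_id x 1).
  by apply: (is_derive_eq h); rewrite mul0r add0r mulr1.
have cf : {within `[a, b], continuous f}.
  apply: within_continuous_lamM => //.
  by apply: continuous_subspaceT; exact: continuous_expR_affine.
have cg : {within `[a, b], continuous (fun x => C * x)}.
  by apply: continuous_subspaceT => x; apply: continuousM; [exact: cst_continuous | exact: cvg_id].
have := derive_le hf hg cf cg _ t tab.
have -> : f a = u a by rewrite /f subrr mulr0 expR0 mulr1.
rewrite -mulrBr => H.
have {}H : f t - u a <= C * (t - a).
  apply: H => x xab; have := xab; rewrite in_itv /= => /andP[ax xb].
  have e1 : expR (- K * (x - a)) <= 1.
    by rewrite -expR0 ler_expR mulNr oppr_le0 mulr_ge0 // subr_ge0 ltW.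
  have e0 := expR_ge0 (- K * (x - a)).
  have := le x xab; set E := expR _ in e0 e1 *; move=> {}le.
  rewrite (_ : _ + _ = (du x - K * u x) * E); last by ring.
  apply: (@le_trans _ _ (C * E)); last by rewrite ler_piMr.
  by rewrite ler_wpM2r //; lra.
have -> : u t = f t * expR (K * (t - a)).
  by rewrite /f mulNr expRN mulfVK // gt_eqF // expR_gt0.
by rewrite ler_wpM2r ?expR_ge0 //; lra.
Qed.

Lemma ler_sum1 (I : finType) (F : I -> R) (i : I) : (forall j, 0 <= F j) ->
  F i <= \sum_j F j.
Proof. by move=> F0; rewrite (bigD1 i) //= lerDl sumr_ge0. Qed.

Lemma within_uniform_limit f a b :
  (forall e, 0 < e -> exists2 g, {within `[a, b], continuous g}
     & forall t, t \in `[a, b] -> `|g t - f t| <= e) ->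
  {within `[a, b], continuous f}.
Proof.
move=> H; apply/subspace_continuousP => x xab; apply/cvgrPdist_le => e e0.
have e3 : 0 < e / 3 by rewrite divr_gt0.
have [g cg fg] := H _ e3.
move/subspace_continuousP : cg => /(_ x xab)/cvgrPdist_le/(_ _ e3) cg.
near=> y.
have yab : y \in `[a, b] by near: y; apply: withinT.
have h1 := fg _ yab; have h2 := fg _ xab.
have h3 : `|g x - g y| <= e / 3 by near: y.
rewrite (_ : f x - f y = (g y - f y) - (g x - f x) + (g x - g y)); last by ring.
rewrite (le_trans (ler_normD _ _)) // (le_trans (lerD (ler_normB _ _) (lexx _))) //.
lra.
Unshelve. all: by end_near. Qed.

Lemma geometric_majorant_cvg (d : nat -> R) (B : R) :
  (forall m, `|d m| <= B * 2^-1 ^+ m) ->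
  exists s, forall m, `|\sum_(k < m) d k - s| <= 2 * B * 2^-1 ^+ m.
Proof.
move=> hd.
have B0 : 0 <= B by have := hd 0%N; rewrite expr0 mulr1; apply: le_trans.
have tail m p : `|\sum_(m <= k < m + p) d k| <= 2 * B * 2^-1 ^+ m.
  suff h : `|\sum_(m <= k < m + p) d k| <=
      2 * B * 2^-1 ^+ m - 2 * B * 2^-1 ^+ (m + p).
    apply: (le_trans h); rewrite lerBlDr lerDl mulr_ge0 ?exprn_ge0 ?mulr_ge0 //.
  elim: p => [|p IHp]; first by rewrite addn0 big_geq // normr0 subrr.
  rewrite addnS big_nat_recr ?leq_addr //=.
  rewrite (le_trans (ler_normD _ _)) // (le_trans (lerD IHp (hd _))) //.
  by rewrite exprS; lra.
pose u := series d.
have uE m : u m = \sum_(k < m) d k by rewrite /u /series /= big_mkord.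
have cu : cvgn u.
  have v0 m : 0 <= B * 2^-1 ^+ m by rewrite mulr_ge0 // exprn_ge0 // invr_ge0.
  have cv : cvgn (series (geometric B 2^-1)).
    by apply: is_cvg_geometric_series; rewrite ger0_norm ?invf_lt1 ?ltr1n.
  by apply: normed_cvg; exact: (series_le_cvg (fun m => normr_ge0 (d m)) v0 hd cv).
exists (limn u) => m; rewrite -uE.
have h : (fun p => `|u m - u p|) @ \oo --> `|u m - limn u|.
  by apply: cvg_norm; apply: cvgB; [exact: cvg_cst | exact: cu].
apply: (@cvgr_to_le _ _ _ _ _ _ _ h).
near=> p.
have mp : (m <= p)%N by near: p; exact: nbhs_infty_ge.
have := tail m (p - m)%N; rewrite subnKC // -sub_series_geq //.
by rewrite distrC.
Unshelve. all: by end_near. Qed.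

Lemma geometric_small (c e : R) : 0 < e -> exists m, c * 2^-1 ^+ m <= e.
Proof.
move=> e0; have h : (fun m => c * 2^-1 ^+ m) @ \oo --> 0.
  by apply: (@cvg_geometric _ c); rewrite ger0_norm ?invf_lt1 ?ltr1n.
have [m _ hm] := (@cvgrPdist_le _ _ _ _ _ _ _).1 h _ e0.
exists m; have := hm m (leqnn m); rewrite /= sub0r normrN.
exact: ler_normlW.
Qed.

Section Picard.
Variables (n : nat) (Q : R -> 'I_n -> 'I_n -> R) (s0 : 'I_n -> R) (a b : R).
Hypothesis ab : a < b.
Hypothesis cQ : forall i j, {within `[a, b], continuous (fun t => Q t i j)}.

(** The terms of the Picard series: each one is integrated from the previous
    one, so that their sum solves the equation at least formally. *)
Lemma picard_terms : exists d : nat -> R -> 'I_n -> R,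
  [/\ forall t i, d 0%N t i = s0 i,
      forall m i, {within `[a, b], continuous (fun t => d m t i)},
      forall m i, d m.+1 a i = 0
    & forall m i t, t \in `]a, b[ ->
      is_derive t 1 (fun x => d m.+1 x i) (\sum_(j < n) Q t i j * d m t j)].
Proof.
pose T := {d : R -> 'I_n -> R | forall i, {within `[a, b], continuous (fun t => d t i)}}.
have step (d : T) : {d' : T | (forall i, sval d' a i = 0) /\
    forall i t, t \in `]a, b[ ->
      is_derive t 1 (fun x => sval d' x i) (\sum_(j < n) Q t i j * sval d t j)}.
  apply: cid.
  have h i : exists F : R -> R, [/\ F a = 0, {within `[a, b], continuous F}
      & forall t, t \in `]a, b[ ->
        is_derive t 1 F (\sum_(j < n) Q t i j * sval d t j)].
    apply: antiderivative => //; apply: within_continuous_lam_sum => j.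
    by apply: within_continuous_lamM; [exact: cQ | exact: (svalP d)].
  pose F i := sval (cid (h i)).
  have hF i : [/\ F i a = 0, {within `[a, b], continuous (F i)}
      & forall t, t \in `]a, b[ ->
        is_derive t 1 (F i) (\sum_(j < n) Q t i j * sval d t j)].
    exact: (svalP (cid (h i))).
  have cF i : {within `[a, b], continuous (fun t => F i t)} by have [] := hF i.
  exists (exist _ (fun t i => F i t) cF) => /=.
  by split=> [i|i t tab]; have [F0 _ dF] := hF i => //; exact: dF.
have c0 (i : 'I_n) : {within `[a, b], continuous (fun _ : R => s0 i)}.
  by apply: continuous_subspaceT => x; exact: cst_continuous.
pose fix d (m : nat) : T := match m with
  | 0 => exist _ (fun _ => s0) c0 | m'.+1 => sval (step (d m')) end.
exists (fun m => sval (d m)); split => //.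
- by move=> m i; exact: (svalP (d m)).
- by move=> m i; have [] := svalP (step (d m)).
- by move=> m i t tab; have [_] := svalP (step (d m)); apply.
Qed.

Lemma matrix_bounded : exists2 K, 0 < K &
  forall t i, t \in `[a, b] -> \sum_(j < n) `|Q t i j| <= K.
Proof.
have h i j : {M | 0 <= M & forall t, t \in `[a, b] -> `|Q t i j| <= M}.
  by apply: cid2; exact: continuous_bounded.
pose M i j := s2val (h i j).
have M0 i j : 0 <= M i j := s2valP (h i j).
exists (1 + \sum_i \sum_j M i j).
  by rewrite ltr_pwDl // sumr_ge0 // => i _; exact: sumr_ge0.
move=> t i tab; rewrite (@le_trans _ _ (\sum_(j < n) M i j)) //.
  by apply: ler_sum => j _; exact: (s2valP' (h i j)).
rewrite (@le_trans _ _ (\sum_i \sum_j M i j)) ?lerDr //.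
by apply: (@ler_sum1 _ (fun i => \sum_j M i j)) => k; exact: sumr_ge0.
Qed.

(** Measured against the weight e^(2K(t - a)), where K bounds the matrix, one
    integration of the equation halves the size of a Picard term.  The series is
    therefore dominated by a geometric one, uniformly on the interval, and its
    sum satisfies the integral equation. *)
Lemma linear_ode : exists s : R -> 'I_n -> R,
  [/\ forall i, s a i = s0 i,
      forall i, {within `[a, b], continuous (fun t => s t i)}
    & forall t i, t \in `]a, b[ ->
      is_derive t 1 (fun x => s x i) (\sum_(j < n) Q t i j * s t j)].
Proof.
have [d [d0 cd da dd]] := picard_terms.
have [K K0 QK] := matrix_bounded.
pose C := \sum_i `|s0 i|.
pose E t := expR (2 * K * (t - a)).
have C0 : 0 <= C by rewrite sumr_ge0.
have E1 t : t \in `[a, b] -> 1 <= E t.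
  rewrite in_itv /= => /andP[at_ _]; rewrite -expR0 ler_expR mulr_ge0 ?subr_ge0 //.
  by rewrite mulr_ge0 // ltW.
have QB t i (v : 'I_n -> R) B : t \in `[a, b] -> (forall j, `|v j| <= B) ->
    `|\sum_(j < n) Q t i j * v j| <= K * B.
  move=> tab vB; rewrite (le_trans (ler_norm_sum _ _ _)) //.
  apply: (@le_trans _ _ (\sum_(j < n) `|Q t i j| * B)).
    by apply: ler_sum => j _; rewrite normrM ler_wpM2l.
  rewrite -mulr_suml ler_wpM2r ?QK //.
  by have := vB i; apply: le_trans.
have hd m : forall t i, t \in `[a, b] -> `|d m t i| <= C * 2^-1 ^+ m * E t.
  elim: m => [|m IHm] t i tab.
    rewrite d0 expr0 mulr1 (@le_trans _ _ C) //; last by rewrite ler_peMr ?E1.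
    by apply: (@ler_sum1 _ (fun i => `|s0 i|)).
  pose g x := C * 2^-1 ^+ m.+1 * E x.
  have hg x : x \in `]a, b[ -> is_derive x 1 g (K * (C * 2^-1 ^+ m * E x)).
    move=> _; have h := is_derive_lamM
      (is_derive_cst (C * 2^-1 ^+ m.+1) x 1) (is_derive_expR_affine (2 * K) a x).
    apply: (is_derive_eq h); rewrite mul0r add0r exprS /E /cst.
    by move: (2^-1 ^+ m) (expR _) => p e; field.
  have cg : {within `[a, b], continuous g}.
    apply: within_continuous_lamM; apply: continuous_subspaceT.
      by move=> x; exact: cst_continuous.
    exact: continuous_expR_affine.
  have sub x : x \in `]a, b[ -> x \in `[a, b] by exact: subset_itv_oo_cc.
  have b1 x : x \in `]a, b[ ->
      `|\sum_(j < n) Q x i j * d m x j| <= K * (C * 2^-1 ^+ m * E x).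
    by move=> xab; apply: QB => [|j]; [exact: sub | apply: IHm; exact: sub].
  have ga : 0 <= g a.
    by rewrite mulr_ge0 ?expR_ge0 // mulr_ge0 // exprn_ge0 // invr_ge0.
  have := derive_norm_le (dd m i) hg (cd m.+1 i) cg b1 t tab.
  by rewrite da subr0 => /le_trans; apply; rewrite -/(g t) lerBlDr lerDl.
pose B := C * E b.
have B0 : 0 <= B by rewrite mulr_ge0 ?expR_ge0.
have [s hs] : {s : R -> 'I_n -> R | forall t i, t \in `[a, b] ->
    forall m, `|\sum_(k < m) d k t i - s t i| <= 2 * B * 2^-1 ^+ m}.
  apply: cid; suff h t i : exists s, t \in `[a, b] ->
      forall m, `|\sum_(k < m) d k t i - s| <= 2 * B * 2^-1 ^+ m.
    exists (fun t i => sval (cid (h t i))) => t i.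
    exact: (svalP (cid (h t i))).
  have [tab|] := boolP (t \in `[a, b]); last by exists 0.
  have [|s hs] := @geometric_majorant_cvg (fun m => d m t i) B.
    move=> m; rewrite (le_trans (hd m t i tab)) // mulrAC.
    rewrite ler_wpM2r ?exprn_ge0 ?invr_ge0 // ler_wpM2l // ler_expR.
    move: tab; rewrite in_itv /= => /andP[_ tb].
    by rewrite ler_wpM2l ?lerD2r // mulr_ge0 // ltW.
  by exists s.
pose S m t i := \sum_(k < m) d k t i.
have cS m i : {within `[a, b], continuous (fun t => S m t i)}.
  by apply: within_continuous_lam_sum.
have cs i : {within `[a, b], continuous (fun t => s t i)}.
  apply: within_uniform_limit => e e0.
  have [m hm] := geometric_small (2 * B) _ e0.
  by exists (fun t => S m t i) => // t tab; exact: le_trans (hs t i tab m) hm.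
have cg i : {within `[a, b], continuous (fun t => \sum_(j < n) Q t i j * s t j)}.
  by apply: within_continuous_lam_sum => j; exact: within_continuous_lamM.
have [G hG] : {G : 'I_n -> R -> R | forall i, [/\ G i a = 0,
    {within `[a, b], continuous (G i)} & forall t, t \in `]a, b[ ->
     is_derive t 1 (G i) (\sum_(j < n) Q t i j * s t j)]}.
  apply: cid; exists (fun i => sval (cid (antiderivative ab (cg i)))) => i.
  exact: (svalP (cid (antiderivative ab (cg i)))).
have sub x : x \in `]a, b[ -> x \in `[a, b] by exact: subset_itv_oo_cc.
have dS m i t : t \in `]a, b[ ->
    is_derive t 1 (fun x => S m.+1 x i) (\sum_(j < n) Q t i j * S m t j).
  move=> tab; have h : is_derive t 1 (fun x => s0 i + \sum_(k < m) d k.+1 x i)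
      (0 + \sum_(k < m) \sum_(j < n) Q t i j * d k t j).
    apply: is_derive_lamD.
    by apply: is_derive_lam_sum => k; exact: dd.
  rewrite (_ : (fun x => _) = (fun x => s0 i + \sum_(k < m) d k.+1 x i)); last first.
    by apply/funext => x; rewrite /S big_ord_recl d0.
  apply: (is_derive_eq h); rewrite add0r exchange_big; apply: eq_bigr => j _.
  by rewrite mulr_sumr.
have sE t i : t \in `[a, b] -> s t i = s0 i + G i t.
  move=> tab; apply/eqP; rewrite -subr_eq0 -normr_le0; apply/ler_addgt0Pl => e e0.
  rewrite addr0.
  have [Ga cG dG] := hG i.
  pose c := K * (2 * B) * (b - a) + 2 * B.
  have [m hm] := geometric_small c _ e0.
  apply: le_trans hm.
  have := tab; rewrite in_itv /= => /andP[at_ tb].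
  have subt x : x \in `]a, t[ -> x \in `]a, b[.
    by rewrite !in_itv /= => /andP[-> xt]; rewrite (lt_le_trans xt tb).
  have du x : x \in `]a, t[ -> is_derive x 1 (fun x => S m.+1 x i - G i x)
      (\sum_(j < n) Q x i j * S m x j - \sum_(j < n) Q x i j * s x j).
    by move=> /subt xab; apply: is_derive_lamB; [exact: dS | exact: dG].
  have cu : {within `[a, t], continuous (fun x => S m.+1 x i - G i x)}.
    by apply: (@within_continuousB _ _ _ _ (fun x => S m.+1 x i) (G i));
      exact: (within_subitv (lexx a) tb).
  have bu x : x \in `]a, t[ ->
      `|\sum_(j < n) Q x i j * S m x j - \sum_(j < n) Q x i j * s x j| <=
        K * (2 * B * 2^-1 ^+ m).
    move=> /subt /sub xab; rewrite -sumrB.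
    under eq_bigr do rewrite -mulrBr.
    by apply: QB => // j; exact: hs.
  have H := derive_norm_le_cst at_ du cu bu.
  have Sa : S m.+1 a i = s0 i.
    by rewrite /S big_ord_recl d0 big1 ?addr0 // => k _; rewrite da.
  rewrite Sa Ga subr0 in H.
  have H2 := hs t i tab m.+1.
  rewrite (_ : _ - _ = (S m.+1 t i - G i t - s0 i) - (S m.+1 t i - s t i)); last by ring.
  rewrite (le_trans (ler_normB _ _)) // (le_trans (lerD H H2)) //.
  have p0 : 0 <= 2^-1 ^+ m :> R by rewrite exprn_ge0 // invr_ge0.
  move: p0; rewrite exprS /c; move: (2^-1 ^+ m) => p p0.
  have h1 : K * (2 * B * p) * (t - a) <= K * (2 * B * p) * (b - a).
    rewrite ler_wpM2l ?lerD2r // mulr_ge0 ?(ltW K0) //.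
    by rewrite mulr_ge0 // mulr_ge0.
  have h2 : 0 <= B * p by rewrite mulr_ge0.
  lra.
exists s; split => //.
- move=> i; rewrite sE ?in_itv /= ?lexx ?ltW //.
  by have [-> _ _] := hG i; rewrite addr0.
- move=> t i tab; have [_ _ dG] := hG i.
  have h : is_derive t 1 (fun x => s0 i + G i x) (0 + \sum_(j < n) Q t i j * s t j).
    by apply: is_derive_lamD; exact: dG.
  rewrite add0r in h; apply: near_eq_is_derive h.
  near=> x; rewrite sE //; apply: sub; near: x.
  by apply: near_in_itvoo.
Unshelve. all: by end_near. Qed.
End Picard.
End LinearODE.

(** * Flat linear systems in the plane *)

Section TwoVariables.
Context {R : realType}.
Implicit Types (a b t x y : R) (f g : R -> R).

Lemma derivative_within_continuous f (df : R -> R) a b :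
  (forall x, is_derive x 1 f (df x)) -> {within `[a, b], continuous f}.
Proof.
move=> hf; apply: continuous_subspaceT => x.
by apply/differentiable_continuous/derivable1_diffP; have [] := hf x.
Qed.

Lemma mvt_norm f (df : R -> R) C x0 d : (forall x, is_derive x 1 f (df x)) ->
  (forall x, `|x - x0| < d -> `|df x| <= C) ->
  forall x, `|x - x0| < d -> `|f x - f x0| <= C * `|x - x0|.
Proof.
move=> hf le x xd.
have [xx0|/ltW xx0] := leP x0 x.
  rewrite (ger0_norm (_ : 0 <= x - x0)) ?subr_ge0 //.
  apply: (derive_norm_le_cst xx0 (fun x _ => hf x)).
    exact: derivative_within_continuous.
  move=> z; rewrite in_itv /= => /andP[xz zx]; apply: le.
  by move: xd; rewrite !ger0_norm ?subr_ge0 // ?(ltW xz) //; lra.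
rewrite distrC (distrC x) (ger0_norm (_ : 0 <= x0 - x)) ?subr_ge0 //.
apply: (derive_norm_le_cst xx0 (fun x _ => hf x)).
  exact: derivative_within_continuous.
move=> z; rewrite in_itv /= => /andP[xz zx]; apply: le.
by move: xd; rewrite distrC (distrC z) !ger0_norm ?subr_ge0 // ?(ltW zx) //; lra.
Qed.

Lemma is_derive_littleo f x d :
  (forall e, 0 < e -> \forall z \near x, `|f z - f x - (z - x) * d| <= e * `|z - x|) ->
  is_derive x 1 f d.
Proof.
move=> H; suff h : (fun h => h^-1 *: ((f \o shift x) (h *: 1) - f x)) @ 0^' --> d.
  by apply: DeriveDef; [apply/cvg_ex; exists d | apply/cvg_lim].
apply/cvgrPdist_le => e e0.
have [r /= r0 Hr] := H e e0.
near=> k.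
have k0 : k != 0 by near: k; exact: nbhs_dnbhs_neq.
have kr : ball x r (k + x).
  rewrite /ball /= distrC addrK.
  by near: k; apply: dnbhs0_lt.
have Hk : `|f (k + x) - f x - k * d| <= e * `|k|.
  by have := Hr _ kr; rewrite addrK.
rewrite /= /GRing.scale /= mulr1 distrC.
rewrite -(ler_pM2l (_ : 0 < `|k|)) ?normr_gt0 // -normrM [_ * e]mulrC.
by rewrite mulrBr mulrA mulfV // mul1r.
Unshelve. all: by end_near. Qed.

Lemma continuous2_comp {T U V W : topologicalType} (F : U -> V -> W)
    (u : T -> U) (v : T -> V) (z : T) :
  {for z, continuous u} -> {for z, continuous v} ->
  {for (u z, v z), continuous (fun p : U * V => F p.1 p.2)} ->
  {for z, continuous (fun z => F (u z) (v z))}.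
Proof. by move=> cu cv cF; exact: (cvg_comp2 cu cv cF). Qed.

(** Compactness of the segment turns joint continuity into continuity at x0
    that is uniform along it. *)
Lemma uniform_near_segment (F : R -> R -> R) x0 a b e :
  continuous (fun z : R * R => F z.1 z.2) -> 0 < e ->
  \forall x \near x0, forall y, y \in `[a, b] -> `|F x y - F x0 y| <= e.
Proof.
move=> cF e0.
have := (compact_near_coveringP `[a, b]).1 (@segment_compact _ a b).
move=> /(_ R (nbhs x0) (fun x y => `|F x y - F x0 y| <= e) _); apply.
move=> y0 _; have e2 : 0 < e / 2 by rewrite divr_gt0.
have h1 := (@cvgrPdist_le _ _ _ _ _ _ _).1 (cF (x0, y0)) _ e2.
have cF2 : {for (y0, x0), continuous (fun z : R * R => F x0 z.1)}.
  by apply: continuous2_comp (cF _); [exact: cst_continuous | exact: cvg_fst].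
have h2 := (@cvgrPdist_le _ _ _ _ _ _ _).1 cF2 _ e2.
have cF3 : {for (y0, x0), continuous (fun z : R * R => F z.2 z.1)}.
  by apply: continuous2_comp (cF _); [exact: cvg_snd | exact: cvg_fst].
have h3 := (@cvgrPdist_le _ _ _ _ _ _ _).1 cF3 _ e2.
near=> z.
have l2 : `|F x0 y0 - F x0 z.1| <= e / 2 by near: z; exact: h2.
have l3 : `|F x0 y0 - F z.2 z.1| <= e / 2 by near: z; exact: h3.
rewrite (_ : F z.2 z.1 - _ = (F x0 y0 - F x0 z.1) - (F x0 y0 - F z.2 z.1)); last by ring.
by rewrite (le_trans (ler_normB _ _)) // (splitr e) lerD.
Unshelve. all: by end_near. Qed.


Lemma is_derive_norm2 n (v dv : R -> 'I_n -> R) t :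
  (forall i, is_derive t 1 (fun x => v x i) (dv t i)) ->
  is_derive t 1 (fun x => \sum_i v x i ^+ 2) (\sum_i 2 * (v t i * dv t i)).
Proof.
move=> hv; apply: is_derive_lam_sum => i.
have h := is_derive_lamM (hv i) (hv i).
have -> : (fun y => v y i ^+ 2) = (fun y => v y i * v y i).
  by apply/funext => y; rewrite expr2.
by apply: (is_derive_eq h); ring.
Qed.

Lemma quadratic_form_le n (Q : 'I_n -> 'I_n -> R) (v : 'I_n -> R) M :
  0 <= M -> (forall i j, `|Q i j| <= M) ->
  `|\sum_i 2 * (v i * \sum_j Q i j * v j)| <= 2 * n%:R * M * \sum_i v i ^+ 2.
Proof.
move=> M0 QM; rewrite (le_trans (ler_norm_sum _ _ _)) //.
have h i : `|2 * (v i * \sum_j Q i j * v j)| <= \sum_j M * (v i ^+ 2 + v j ^+ 2).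
  rewrite mulr_sumr mulr_sumr (le_trans (ler_norm_sum _ _ _)) //.
  apply: ler_sum => j _.
  rewrite (_ : 2 * (v i * (Q i j * v j)) = Q i j * (2 * v i * v j)); last by ring.
  rewrite normrM ler_pM ?QM // ler_norml.
  have h1 := sqr_ge0 (v i + v j); have h2 := sqr_ge0 (v i - v j).
  rewrite sqrrD in h1; rewrite sqrrB in h2.
  by apply/andP; split; lra.
rewrite (le_trans (ler_sum _ (fun i _ => h i))) //.
under eq_bigr do rewrite -mulr_sumr big_split /= sumr_const card_ord -mulr_natl.
rewrite -mulr_sumr big_split /= -mulr_sumr sumr_const card_ord -mulr_natl.
by rewrite le_eqVlt; apply/orP; left; apply/eqP; ring.
Qed.

Section Energy.
Variables (n : nat) (Q : R -> 'I_n -> 'I_n -> R) (a b M : R).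
Variables (v : R -> 'I_n -> R).
Hypothesis M0 : 0 <= M.
Hypothesis QM : forall t i j, t \in `]a, b[ -> `|Q t i j| <= M.
Hypothesis cv : forall i, {within `[a, b], continuous (fun t => v t i)}.

Let cu : {within `[a, b], continuous (fun t => \sum_i v t i ^+ 2)}.
Proof.
apply: within_continuous_lam_sum => i.
rewrite (_ : (fun _ => _) = (fun y => v y i * v y i)).
  exact: within_continuous_lamM.
by apply/funext => y; rewrite expr2.
Qed.

(** Gronwall's inequality for the squared length of v. *)
Lemma energy_estimate (r : R -> 'I_n -> R) rho :
  (forall t i, t \in `]a, b[ ->
     is_derive t 1 (fun x => v x i) (\sum_j Q t i j * v t j + r t i)) ->
  (forall t i, t \in `]a, b[ -> `|r t i| <= rho) ->
  forall t, t \in `[a, b] -> \sum_i v t i ^+ 2 <=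
    (\sum_i v a i ^+ 2 + n%:R * rho ^+ 2 * (t - a)) *
      expR ((2 * n%:R * M + 1) * (t - a)).
Proof.
move=> dv rr.
apply: (gronwall _ (fun t => \sum_i 2 * (v t i * (\sum_j Q t i j * v t j + r t i)))) => //.
- by rewrite addr_ge0 // !mulr_ge0.
- by rewrite mulr_ge0 // sqr_ge0.
- move=> t tab.
  apply: (is_derive_norm2 _ _ (fun t i => \sum_j Q t i j * v t j + r t i)) => i.
  exact: dv.
- move=> t tab; under eq_bigr do rewrite mulrDr mulrDr.
  rewrite big_split /= mulrDl mul1r -addrA lerD //.
    by apply: ler_normlW; apply: quadratic_form_le => // i j; exact: QM.
  have -> : n%:R * rho ^+ 2 = \sum_(i < n) rho ^+ 2.
    by rewrite sumr_const card_ord mulr_natl.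
  rewrite -big_split /=.
  apply: ler_sum => i _.
  have h1 : r t i ^+ 2 <= rho ^+ 2.
    rewrite -[leLHS]real_normK ?num_real // lerXn2r ?nnegrE ?rr //.
    by rewrite (le_trans _ (rr t i tab)).
  have := sqr_ge0 (v t i - r t i); rewrite sqrrB; lra.
Qed.

(** A homogeneous linear equation cannot decrease the squared length faster
    than exponentially; in particular a solution that vanishes somewhere
    vanishes at the initial point. *)
Lemma energy_lower :
  (forall t i, t \in `]a, b[ ->
     is_derive t 1 (fun x => v x i) (\sum_j Q t i j * v t j)) ->
  forall t, t \in `[a, b] ->
   \sum_i v a i ^+ 2 <= \sum_i v t i ^+ 2 * expR (2 * n%:R * M * (t - a)).
Proof.
move=> dv t tab; rewrite -mulr_suml; set K := 2 * n%:R * M.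
have := tab; rewrite in_itv /= => /andP[at_ tb].
pose u x := \sum_i v x i ^+ 2.
pose du x := \sum_i 2 * (v x i * \sum_j Q x i j * v x j).
have hf x : x \in `]a, t[ -> is_derive x 1 (fun x => u x * expR (K * (x - a)))
    (du x * expR (K * (x - a)) + u x * (K * expR (K * (x - a)))).
  move=> xat; apply: is_derive_lamM; last exact: is_derive_expR_affine.
  apply: (is_derive_norm2 _ _ (fun t i => \sum_j Q t i j * v t j)) => i.
  by apply: dv; apply: subset_itvl xat; rewrite bnd_simp.
have cf : {within `[a, t], continuous (fun x => u x * expR (K * (x - a)))}.
  apply: (within_subitv (lexx a) tb); apply: within_continuous_lamM => //.
  by apply: continuous_subspaceT; exact: continuous_expR_affine.
have := derive_ge0_le at_ hf cf; rewrite subrr mulr0 expR0 mulr1; apply.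
move=> x xat; rewrite mulrA -mulrDl mulr_ge0 ?expR_ge0 //.
have xab : x \in `]a, b[ by apply: subset_itvl xat; rewrite bnd_simp.
have := quadratic_form_le n (Q x) (v x) M M0 (fun i j => QM x i j xab).
rewrite ler_norml -/(du x) -/(u x) -/K => /andP[h _].
by rewrite [u x * K]mulrC -lerBlDr sub0r.
Qed.

End Energy.

Lemma sum_sqr_eq0 n (v : 'I_n -> R) : \sum_i v i ^+ 2 <= 0 -> forall i, v i = 0.
Proof.
move=> h i; apply/eqP; rewrite -sqrf_eq0 -(le_anti (introT andP (conj _ (sqr_ge0 (v i))))) //.
by apply: le_trans h; apply: (ler_sum1 _ (fun i => v i ^+ 2)) => j; exact: sqr_ge0.
Qed.

Lemma bounded_entries {n} {Q : R -> 'I_n -> 'I_n -> R} {a b} :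
  (forall i j, {within `[a, b], continuous (fun t => Q t i j)}) ->
  exists2 M, 0 <= M & forall t i j, t \in `[a, b] -> `|Q t i j| <= M.
Proof.
move=> cQ; have [K K0 QK] := matrix_bounded _ _ _ _ cQ.
exists K => [|t i j tab]; first exact: ltW.
apply: le_trans (QK t i tab).
by apply: (ler_sum1 _ (fun j => `|Q t i j|)).
Qed.

Lemma linear_ode_unique n (Q : R -> 'I_n -> 'I_n -> R) a b (u v : R -> 'I_n -> R) :
  (forall i j, {within `[a, b], continuous (fun t => Q t i j)}) ->
  (forall i, {within `[a, b], continuous (fun t => u t i)}) ->
  (forall i, {within `[a, b], continuous (fun t => v t i)}) ->
  (forall t i, t \in `]a, b[ ->
     is_derive t 1 (fun x => u x i) (\sum_j Q t i j * u t j)) ->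
  (forall t i, t \in `]a, b[ ->
     is_derive t 1 (fun x => v x i) (\sum_j Q t i j * v t j)) ->
  (forall i, u a i = v a i) ->
  forall t i, t \in `[a, b] -> u t i = v t i.
Proof.
move=> cQ cu cv du dv uv t i tab.
have [M M0 QM] := bounded_entries cQ.
have sub x : x \in `]a, b[ -> x \in `[a, b] by exact: subset_itv_oo_cc.
have cw j : {within `[a, b], continuous (fun t => u t j - v t j)}.
  exact: (@within_continuousB _ _ _ _ (fun t => u t j) (fun t => v t j)).
have dw x j : x \in `]a, b[ -> is_derive x 1 (fun t => u t j - v t j)
    (\sum_k Q x j k * (u x k - v x k) + 0).
  move=> xab; have h := is_derive_lamB (du x j xab) (dv x j xab).
  apply: (is_derive_eq h); rewrite addr0 -sumrB; apply: eq_bigr => k _.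
  by rewrite mulrBr.
have := energy_estimate _ Q _ _ _ (fun t j => u t j - v t j) M0
  (fun t i j h => QM t i j (sub t h)) cw (fun _ _ => 0) 0 dw.
have r0 : `|0 : R| <= 0 by rewrite normr0.
move=> /(_ (fun _ _ _ => r0) t tab) h; apply/eqP; rewrite -subr_eq0; apply/eqP.
apply: (sum_sqr_eq0 _ (fun j => u t j - v t j)); apply: le_trans h _.
rewrite big1 => [|j _]; last by rewrite uv subrr expr0n.
by rewrite expr0n mulr0 mul0r addr0 mul0r.
Qed.

Lemma continuous_slice2 (F : R -> R -> R) (x : R) :
  continuous (fun z : R * R => F z.1 z.2) -> continuous (fun y => F x y).
Proof.
move=> cF y; apply: (@continuous2_comp _ _ _ _ F (fun=> x) (fun y => y)) (cF _).
  exact: cst_continuous.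
exact: cvg_id.
Qed.

Lemma square_sum_bound n (v : 'I_n -> R) (rho D : R) : 0 <= rho -> 0 <= D ->
  \sum_i v i ^+ 2 <= rho ^+ 2 * D -> forall i, `|v i| <= rho * (1 + D).
Proof.
move=> rho0 D0 h i.
rewrite -(@ler_pXn2r _ 2) ?nnegrE ?mulr_ge0 ?addr_ge0 // real_normK ?num_real //.
apply: (@le_trans _ _ (rho ^+ 2 * D)).
  by apply: le_trans h; apply: (ler_sum1 _ (fun i => v i ^+ 2)) => j; exact: sqr_ge0.
rewrite exprMn ler_wpM2l ?sqr_ge0 // sqrrD expr1n mul1r.
have := sqr_ge0 D; lra.
Qed.

Lemma remainder_eq n (q q' q'' s1 s2 s3 : 'I_n -> R) (h : R) :
  \sum_j q' j * s1 j - \sum_j q j * s2 j - h * (\sum_j q'' j * s2 j + \sum_j q j * s3 j) =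
  \sum_j q' j * (s1 j - s2 j - h * s3 j) +
  (\sum_j (q' j - q j - h * q'' j) * s2 j + h * \sum_j (q' j - q j) * s3 j).
Proof.
rewrite -[_ + \sum_j q j * s3 j]big_split /= !mulr_sumr -!sumrB.
rewrite -[X in _ = _ + X]big_split -big_split /=.
by apply: eq_bigr => j _; ring.
Qed.

End TwoVariables.

Section FlatSystem.
Context {R : realType}.
Implicit Types (x y : R).
Variables (n : nat) (P Q Py Qx : R -> R -> 'I_n -> 'I_n -> R) (a b : R).
Variables (s0 : 'I_n -> R).
Hypothesis ab : a < b.
Hypothesis cP : forall i j, continuous (fun z : R * R => P z.1 z.2 i j).
Hypothesis cQ : forall i j, continuous (fun z : R * R => Q z.1 z.2 i j).
Hypothesis cQx : forall i j, continuous (fun z : R * R => Qx z.1 z.2 i j).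
Hypothesis dPy : forall x y i j, is_derive y 1 (fun y => P x y i j) (Py x y i j).
Hypothesis dQx : forall x y i j, is_derive x 1 (fun x => Q x y i j) (Qx x y i j).
Hypothesis flat : forall x y i j,
  Py x y i j + \sum_k P x y i k * Q x y k j =
  Qx x y i j + \sum_k Q x y i k * P x y k j.
Hypothesis Pa : forall x i j, P x a i j = 0.

Lemma uniform_near_entries (F : R -> R -> 'I_n -> 'I_n -> R) x0 e :
  (forall i j, continuous (fun z : R * R => F z.1 z.2 i j)) -> 0 < e ->
  \forall x \near x0, forall i j y, y \in `[a, b] ->
    `|F x y i j - F x0 y i j| <= e.
Proof.
move=> cF e0.
pose f (ij : 'I_n * 'I_n) := [set x | forall y, y \in `[a, b] ->
  `|F x y ij.1 ij.2 - F x0 y ij.1 ij.2| <= e].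
have /(@filter_forall _ _ f) : forall ij, \forall x \near x0, f ij x.
  by move=> ij; apply: (uniform_near_segment (fun x y => F x y ij.1 ij.2)) => //; exact: cF.
by apply: filterS => x H i j; exact: (H (i, j)).
Qed.

Let wQ x i j : {within `[a, b], continuous (fun y => Q x y i j)}.
Proof.
apply: continuous_subspaceT.
exact: (continuous_slice2 (fun x y => Q x y i j)).
Qed.

Let wP x i j : {within `[a, b], continuous (fun y => P x y i j)}.
Proof.
apply: continuous_subspaceT.
exact: (continuous_slice2 (fun x y => P x y i j)).
Qed.

Variable s : R -> R -> 'I_n -> R.
Hypothesis sa : forall x i, s x a i = s0 i.
Hypothesis cs : forall x i, {within `[a, b], continuous (fun y => s x y i)}.
Hypothesis dsy : forall x y i, y \in `]a, b[ ->
  is_derive y 1 (fun y => s x y i) (\sum_j Q x y i j * s x y j).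

Let oo_cc y : y \in `]a, b[ -> y \in `[a, b].
Proof. exact: subset_itv_oo_cc. Qed.

Let Q_bound x0 : exists2 M, 0 <= M & \forall x \near x0,
  forall y i j, y \in `[a, b] -> `|Q x y i j| <= M.
Proof.
have [M M0 QM] := bounded_entries (wQ x0).
exists (M + 1); first by rewrite addr_ge0.
have H := uniform_near_entries Q x0 1 cQ ltr01.
near=> x => y i j yab.
have h : `|Q x y i j - Q x0 y i j| <= 1.
  by have Hx : forall i j y, y \in `[a, b] -> `|Q x y i j - Q x0 y i j| <= 1;
    [near: x | exact: Hx].
have -> : Q x y i j = Q x0 y i j + (Q x y i j - Q x0 y i j) by ring.
by rewrite (le_trans (ler_normD _ _)) // lerD ?QM.
Unshelve. all: by end_near. Qed.

(** Linear dependence of a solution with zero initial value on the source term,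
    with a constant that serves for all x near x0. *)
Let small_solution x0 : exists2 D, 0 <= D & \forall x \near x0,
  forall (v r : R -> 'I_n -> R) rho, 0 <= rho ->
   (forall i, v a i = 0) ->
   (forall i, {within `[a, b], continuous (fun t => v t i)}) ->
   (forall t i, t \in `]a, b[ ->
      is_derive t 1 (fun y => v y i) (\sum_j Q x t i j * v t j + r t i)) ->
   (forall t i, t \in `]a, b[ -> `|r t i| <= rho) ->
   forall t i, t \in `[a, b] -> `|v t i| <= rho * D.
Proof.
have [M M0 QM] := Q_bound x0.
pose K := 2 * n%:R * M + 1.
have K0 : 0 <= K by rewrite addr_ge0 // !mulr_ge0.
pose D := n%:R * (b - a) * expR (K * (b - a)).
have D0 : 0 <= D by rewrite mulr_ge0 ?expR_ge0 // mulr_ge0 // subr_ge0 ltW.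
exists (1 + D); first by rewrite addr_ge0.
near=> x => v r rho rho0 va cv dv rr t i tab.
have QMx : forall y i j, y \in `[a, b] -> `|Q x y i j| <= M by near: x.
apply: square_sum_bound => //.
have := energy_estimate _ _ _ _ _ _ M0 (fun t i j th => QMx t i j (oo_cc t th))
  cv _ _ dv rr t tab.
move=> /le_trans; apply; rewrite big1 => [|j _]; last by rewrite va expr0n.
rewrite add0r /D mulrA (mulrA (rho ^+ 2)) (mulrC (rho ^+ 2)) -/K.
have := tab; rewrite in_itv /= => /andP[at_ tb].
rewrite ler_pM ?expR_ge0 //.
- by rewrite mulr_ge0 ?subr_ge0 // mulr_ge0 // sqr_ge0.
- by rewrite ler_wpM2l ?lerD2r // mulr_ge0 // sqr_ge0.
- by rewrite ler_expR ler_wpM2l // lerD2r.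
Unshelve. all: by end_near. Qed.

(** Solving s_y = Q s along the lines x = const, from initial values that are
    constant in x, produces a solution of s_x = P s when the curvature
    P_y + P Q - Q_x - Q P vanishes and P vanishes on the initial line.  The
    error v = s(x) - s(x0) - (x - x0) P s(x0) of first-order extrapolation
    starts at 0 and satisfies an equation whose source is o(x - x0), because
    the first-order terms are cancelled by flatness; so v is o(x - x0).  No
    differentiability of s in x is presupposed. *)
Lemma flat_transport x0 y0 i : y0 \in `]a, b[ ->
  is_derive x0 1 (fun x => s x y0 i) (\sum_j P x0 y0 i j * s x0 y0 j).
Proof.
move=> y0ab; have [D D0 HD] := small_solution x0.
have [S S0 hS] : exists2 S, 0 <= S & forall t i, t \in `[a, b] -> `|s x0 t i| <= S.
  have [S S0 hS] := bounded_entries (Q := fun t _ j => s x0 t j) (fun _ j => cs x0 j).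
  by exists S => // t k tab; exact: (hS t k k).
have [MP MP0 hMP] := bounded_entries (wP x0).
pose Ps t j := \sum_k P x0 t j k * s x0 t k.
pose MPs := n%:R * (MP * S).
have hPs t j : t \in `[a, b] -> `|Ps t j| <= MPs.
  move=> tab; rewrite (le_trans (ler_norm_sum _ _ _)) //.
  apply: (@le_trans _ _ (\sum_(k < n) MP * S)).
    by apply: ler_sum => k _; rewrite normrM ler_pM ?hMP ?hS.
  by rewrite sumr_const card_ord -[leLHS]mulr_natl.
have MPs0 : 0 <= MPs by rewrite !mulr_ge0.
apply: is_derive_littleo => e e0.
pose C := n%:R * (S + MPs).
have C0 : 0 <= C by rewrite mulr_ge0 ?addr_ge0.
pose eps := e / (C * D + 1).
have CD0 : 0 < C * D + 1 by rewrite ltr_wpDl //; exact: mulr_ge0.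
have eps0 : 0 < eps by rewrite divr_gt0.
have tQx := uniform_near_entries Qx x0 _ cQx eps0.
have tQ := uniform_near_entries Q x0 _ cQ eps0.
have [d /= d0 hd] := tQx.
have nd : \forall x \near x0, `|x - x0| < d.
  by exists d => //= z; rewrite /ball /= distrC.
near=> x; set h := x - x0.
have xd : `|x - x0| < d by near: x.
have hQ j k t : t \in `[a, b] -> `|Q x t j k - Q x0 t j k| <= eps.
  have Hx : forall i j y, y \in `[a, b] -> `|Q x y i j - Q x0 y i j| <= eps.
    by near: x.
  exact: Hx.
have hQ2 j k t : t \in `[a, b] ->
    `|Q x t j k - Q x0 t j k - h * Qx x0 t j k| <= eps * `|h|.
  move=> tab.
  pose f z := Q z t j k - z * Qx x0 t j k.
  have df (z : R) : is_derive z 1 f (Qx z t j k - Qx x0 t j k).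
    have h1 := is_derive_lamM (is_derive_id z 1)
      (is_derive_cst (Qx x0 t j k) z 1).
    have h2 := is_derive_lamB (dQx z t j k) h1.
    by apply: (is_derive_eq h2); rewrite mulr0 addr0 mul1r.
  have := mvt_norm f _ eps x0 d df _ x xd.
  rewrite /f (_ : _ - _ - (_ - _) = Q x t j k - Q x0 t j k - h * Qx x0 t j k);
    last by rewrite /h; ring.
  apply; move=> z zd; apply: (hd z) => //.
  by rewrite /ball /= distrC.
pose v t j := s x t j - s x0 t j - h * Ps t j.
pose r t j := \sum_k (Q x t j k - Q x0 t j k - h * Qx x0 t j k) * s x0 t k +
  h * \sum_k (Q x t j k - Q x0 t j k) * Ps t k.
have dPs t j : t \in `]a, b[ -> is_derive t 1 (fun y => Ps y j)
    (\sum_k Qx x0 t j k * s x0 t k + \sum_k Q x0 t j k * Ps t k).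
  move=> tab.
  have H := is_derive_lam_sum n (fun k y => P x0 y j k * s x0 y k) t 1 _
    (fun k => is_derive_lamM (dPy x0 t j k) (dsy x0 t k tab)).
  apply: (is_derive_eq H); rewrite big_split /=.
  have E : \sum_k P x0 t j k * \sum_l Q x0 t k l * s x0 t l =
      \sum_l (\sum_k P x0 t j k * Q x0 t k l) * s x0 t l.
    under eq_bigr do rewrite mulr_sumr.
    rewrite exchange_big; apply: eq_bigr => l _; rewrite mulr_suml.
    by apply: eq_bigr => k _; rewrite mulrA.
  have E2 : \sum_k Q x0 t j k * Ps t k =
      \sum_l (\sum_k Q x0 t j k * P x0 t k l) * s x0 t l.
    under eq_bigr do rewrite /Ps mulr_sumr.
    rewrite exchange_big; apply: eq_bigr => l _; rewrite mulr_suml.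
    by apply: eq_bigr => k _; rewrite mulrA.
  rewrite E E2 -!big_split /=; apply: eq_bigr => l _.
  by rewrite -!mulrDl flat.
have cPs j : {within `[a, b], continuous (fun y => Ps y j)}.
  apply: within_continuous_lam_sum => k.
  by apply: within_continuous_lamM.
have va j : v a j = 0.
  rewrite /v !sa subrr sub0r /Ps big1 ?mulr0 ?oppr0 // => k _.
  by rewrite Pa mul0r.
have cv j : {within `[a, b], continuous (fun y => v y j)}.
  apply: (@within_continuousB _ _ _ _ (fun y => s x y j - s x0 y j) (fun y => h * Ps y j)).
    exact: (@within_continuousB _ _ _ _ (fun y => s x y j) (fun y => s x0 y j)).
  apply: within_continuous_lamM => //.
  by apply: continuous_subspaceT => z; exact: cst_continuous.
have dv t j : t \in `]a, b[ ->
    is_derive t 1 (fun y => v y j) (\sum_k Q x t j k * v t k + r t j).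
  move=> tab.
  have h1 := is_derive_lamB (dsy x t j tab) (dsy x0 t j tab).
  have h2 := is_derive_lamM (is_derive_cst h t 1) (dPs t j tab).
  have h3 := is_derive_lamB h1 h2.
  by apply: (is_derive_eq h3); rewrite mul0r add0r /cst remainder_eq.
pose rho := eps * `|h| * C.
have rr t j : t \in `]a, b[ -> `|r t j| <= rho.
  move=> /oo_cc tab.
  have -> : rho = n%:R * (eps * `|h| * S) + `|h| * (n%:R * (eps * MPs)).
    by rewrite /rho /C; ring.
  rewrite /r (le_trans (ler_normD _ _)) // lerD //.
    rewrite (le_trans (ler_norm_sum _ _ _)) //.
    apply: (@le_trans _ _ (\sum_(k < n) eps * `|h| * S)).
      by apply: ler_sum => k _; rewrite normrM ler_pM ?hQ2 ?hS.
    by rewrite sumr_const card_ord -[leLHS]mulr_natl.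
  rewrite normrM ler_wpM2l // (le_trans (ler_norm_sum _ _ _)) //.
  apply: (@le_trans _ _ (\sum_(k < n) eps * MPs)).
    by apply: ler_sum => k _; rewrite normrM ler_pM ?hQ ?hPs.
  by rewrite sumr_const card_ord -[leLHS]mulr_natl.
have rho0 : 0 <= rho by rewrite mulr_ge0 // mulr_ge0 // ltW.
have HDx : forall (v r : R -> 'I_n -> R) rho, 0 <= rho ->
   (forall i, v a i = 0) ->
   (forall i, {within `[a, b], continuous (fun t => v t i)}) ->
   (forall t i, t \in `]a, b[ ->
      is_derive t 1 (fun y => v y i) (\sum_j Q x t i j * v t j + r t i)) ->
   (forall t i, t \in `]a, b[ -> `|r t i| <= rho) ->
   forall t i, t \in `[a, b] -> `|v t i| <= rho * D by near: x.
have := HDx v r rho rho0 va cv dv rr y0 i (oo_cc y0 y0ab).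
rewrite /v -/h => /le_trans; apply.
rewrite /rho /eps (_ : _ * D = (e * `|h|) * (C * D / (C * D + 1))); last by ring.
by rewrite ler_piMr ?mulr_ge0 ?(ltW e0) // ler_pdivrMr // mul1r lerDl.
Unshelve. all: by end_near. Qed.

(** Continuity in y is clear, and continuity in x is uniform in y by the
    energy estimate applied to the difference of two solutions. *)
Lemma flat_continuous i (z0 : R * R) : z0.2 \in `]a, b[ ->
  {for z0, continuous (fun z : R * R => s z.1 z.2 i)}.
Proof.
case: z0 => x0 y0 /= y0ab.
have [D D0 HD] := small_solution x0.
have [S S0 hS] : exists2 S, 0 <= S & forall t i, t \in `[a, b] -> `|s x0 t i| <= S.
  have [S S0 hS] := bounded_entries (Q := fun t _ j => s x0 t j) (fun _ j => cs x0 j).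
  by exists S => // t k tab; exact: (hS t k k).
apply/cvgrPdist_le => e e0.
pose C := n%:R * S.
have C0 : 0 <= C by rewrite mulr_ge0.
have CD0 : 0 < C * D + 1 by rewrite ltr_wpDl //; exact: mulr_ge0.
pose eps := e / 2 / (C * D + 1).
have e20 : 0 < e / 2 by rewrite divr_gt0.
have eps0 : 0 < eps by rewrite divr_gt0.
have tQ := uniform_near_entries Q x0 _ cQ eps0.
have hx : \forall x \near x0, forall t, t \in `[a, b] -> `|s x t i - s x0 t i| <= e / 2.
  near=> x => t tab.
  have hQ j k t' : t' \in `[a, b] -> `|Q x t' j k - Q x0 t' j k| <= eps.
    have Hx : forall i j y, y \in `[a, b] -> `|Q x y i j - Q x0 y i j| <= eps.
      by near: x.
    exact: Hx.
  have HDx : forall (v r : R -> 'I_n -> R) rho, 0 <= rho ->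
     (forall i, v a i = 0) ->
     (forall i, {within `[a, b], continuous (fun t => v t i)}) ->
     (forall t i, t \in `]a, b[ ->
        is_derive t 1 (fun y => v y i) (\sum_j Q x t i j * v t j + r t i)) ->
     (forall t i, t \in `]a, b[ -> `|r t i| <= rho) ->
     forall t i, t \in `[a, b] -> `|v t i| <= rho * D by near: x.
  pose r t j := \sum_k (Q x t j k - Q x0 t j k) * s x0 t k.
  have H : `|s x t i - s x0 t i| <= eps * C * D.
    apply: (HDx (fun t j => s x t j - s x0 t j) r) => //.
    - by rewrite mulr_ge0 // ltW.
    - by move=> j; rewrite !sa subrr.
    - by move=> j; exact: (@within_continuousB _ _ _ _ (fun y => s x y j) (fun y => s x0 y j)).
    - move=> t' j tab'.
      have h1 := is_derive_lamB (dsy x t' j tab') (dsy x0 t' j tab').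
      apply: (is_derive_eq h1); rewrite /r -sumrB -big_split /=.
      by apply: eq_bigr => k _; ring.
    - move=> t' j /oo_cc tab'; rewrite (le_trans (ler_norm_sum _ _ _)) //.
      apply: (@le_trans _ _ (\sum_(k < n) eps * S)).
        by apply: ler_sum => k _; rewrite normrM ler_pM ?hQ ?hS.
      by rewrite sumr_const card_ord /C mulrCA mulr_natl.
  apply: (le_trans H).
  have -> : eps * C * D = (e / 2) * (C * D / (C * D + 1)) by rewrite /eps; ring.
  by rewrite ler_piMr ?(ltW e20) // ler_pdivrMr // mul1r lerDl.
have hy : \forall y \near y0, `|s x0 y0 i - s x0 y i| <= e / 2.
  have cy : {for y0, continuous (fun y => s x0 y i)}.
    apply/differentiable_continuous/derivable1_diffP.
    by have [] := dsy x0 y0 i y0ab.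
  exact: (@cvgrPdist_le _ _ _ _ _ _ _).1 cy _ e20.
have iy : \forall y \near y0, y \in `[a, b].
  by have := near_in_itvoo y0ab; apply: filterS => y; exact: oo_cc.
have h2 : \forall y \near y0, y \in `[a, b] /\ `|s x0 y0 i - s x0 y i| <= e / 2.
  by near=> y; split; near: y.
exists ([set x | forall t, t \in `[a, b] -> `|s x t i - s x0 t i| <= e / 2],
  [set y | y \in `[a, b] /\ `|s x0 y0 i - s x0 y i| <= e / 2]) => //.
move=> [x y] /= [Hx [yab Hy]].
have := Hx y yab; rewrite distrC => Hx'.
rewrite (_ : _ - _ = (s x0 y0 i - s x0 y i) + (s x0 y i - s x y i)); last by ring.
by rewrite (le_trans (ler_normD _ _)) // (splitr e) lerD.
Unshelve. all: by end_near. Qed.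

End FlatSystem.

(** * Continuously differentiable maps *)

Section NearDiff.
Context {R : realType}.

(** The remainder of the expansion of f at x is also that of g. *)
Lemma near_eq_differentiable {V W : normedModType R} (f g : V -> W) (x : V) :
  (\forall y \near x, f y = g y) -> differentiable f x -> differentiable g x.
Proof.
move=> fg df; have fgx : f x = g x := nbhs_singleton fg.
have H : g \o shift x = cst (g x) + 'd f x +o_ 0 id.
  have /eqaddoP H := diff_locally df.
  apply/eqaddoP => e e0; have := H e e0; apply: filter_app.
  have fg0 : \forall h \near (0 : V), f (h + x) = g (h + x).
    have c : (h + x) @[h --> (0 : V)] --> 0 + x.
      by apply: cvgD; [exact: cvg_id | exact: cvg_cst].
    by rewrite add0r in c; exact: (c _ fg).
  near=> h.
  have E : f (h + x) = g (h + x) by near: h.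
  have -> : (g \o shift x - (cst (g x) + 'd f x)) h =
            (f \o shift x - (cst (f x) + 'd f x)) h.
    by rewrite !fctE /= E fgx.
  by [].
have E := diff_unique (diff_continuous df) H.
apply/diff_locallyP; rewrite E; split; [exact: diff_continuous | exact: H].
Unshelve. all: by end_near. Qed.

Lemma near_eq_continuous_at {T U : topologicalType} (f g : T -> U) (x : T) :
  (\forall y \near x, f y = g y) -> {for x, continuous f} ->
  {for x, continuous g}.
Proof.
move=> fg cf; rewrite /prop_for /continuous_at -(nbhs_singleton fg).
by apply: cvg_trans cf; apply: near_eq_cvg; apply: filterS fg => y ->.
Qed.
End NearDiff.

Section C1.
Context {R : realType}.

Lemma derive_comp_real {W : normedModType R} (f : W -> R) (h : R -> R) (x v : W)
    (df dh : R) : differentiable f x -> is_derive x v f df ->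
  is_derive (f x) 1 h dh -> is_derive x v (fun y => h (f y)) (df * dh).
Proof.
move=> dfx [_ <-] [dhx <-].
have dhx' : differentiable h (f x) by apply/derivable1_diffP.
have dhf : differentiable (h \o f) x by exact: differentiable_comp.
have E : 'd (h \o f) x = 'd h (f x) \o 'd f x :> (W -> R) by exact: diff_comp.
apply: DeriveDef; first by apply: diff_derivable; exact: dhf.
transitivity ('d (h \o f) x v); first exact: (deriveE _ dhf).
by rewrite E /= deriv1E // derive1E (deriveE _ dfx).
Qed.

Lemma derive_coord m {W : normedModType R} (F : W -> 'rV[R]_m) (x v : W) i :
  differentiable F x -> is_derive x v (fun y => F y 0 i) (('D_v F x) 0 i).
Proof.
move=> dF; have h : derivable F x v by exact: diff_derivable.
rewrite (derive_mx h) mxE; apply/derivableP.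
exact: (derivable_mxP F x v).1.
Qed.

Lemma is_derive_coord m (p v : 'rV[R]_m) i :
  is_derive p v (fun x : 'rV[R]_m => x 0 i) (v 0 i).
Proof.
have := derive_coord _ (fun x : 'rV[R]_m => x) p v i; rewrite derive_id; apply.
by have [] := is_diff_id p.
Qed.

Lemma differentiable_component m {W : normedModType R} (F : W -> 'rV[R]_m) (x : W) i :
  differentiable F x -> differentiable (fun y => F y 0 i) x.
Proof.
move=> dF; apply: (@differentiable_comp _ _ _ _ F (fun M : 'rV[R]_m => M 0 i)) => //.
exact: differentiable_coord.
Qed.

Lemma Ck1P {V W : normedModType R} {U : set V} {f : V -> W} :
  Ck 1 U f <-> (forall x, U x -> differentiable f x) /\
    (forall v x, U x -> {for x, continuous (fun y => 'D_v f y)}).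
Proof. by []. Qed.

Lemma open_near {V : normedModType R} (U : set V) (x : V) (Q : V -> Prop) :
  open U -> U x -> (forall y, U y -> Q y) -> \forall y \near x, Q y.
Proof.
move=> oU Ux H; have : nbhs x U by exact: open_nbhs_nbhs.
exact: filterS.
Qed.

(** On an open set the directional derivatives may be replaced by any
    functions that agree with them there. *)
Lemma Ck1_intro {V W : normedModType R} (U : set V) (f : V -> W)
    (D : V -> V -> W) : open U ->
  (forall x, U x -> differentiable f x) ->
  (forall v x, U x -> 'D_v f x = D v x) ->
  (forall v x, U x -> {for x, continuous (D v)}) -> Ck 1 U f.
Proof.
move=> oU df E cD; split=> // v x Ux.
apply: (near_eq_continuous_at (D v)); last exact: cD.
by apply: (open_near U) => // y Uy; rewrite E.
Qed.

Lemma Ck1_ext {V W : normedModType R} (U : set V) (f g : V -> W) : open U ->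
  (forall x, U x -> f x = g x) -> Ck 1 U f -> Ck 1 U g.
Proof.
move=> oU fg /Ck1P[df cf]; apply: (Ck1_intro _ _ (fun v x => 'D_v f x)) => //.
- move=> x Ux; apply: (near_eq_differentiable f); last exact: df.
  exact: (open_near U).
- move=> v x Ux; symmetry; apply: near_eq_derive.
  exact: (open_near U).
Qed.

Lemma Ck1_cst {V W : normedModType R} (U : set V) (k : W) : Ck 1 U (fun _ : V => k).
Proof.
split=> [x _|v x _]; first exact: differentiable_cst.
rewrite (_ : (fun y => 'D_v _ y) = cst 0); first exact: cst_continuous.
by apply/funext => y; exact: derive_cst.
Qed.

Lemma Ck1D {V W : normedModType R} (U : set V) (f g : V -> W) : open U ->
  Ck 1 U f -> Ck 1 U g -> Ck 1 U (fun x => f x + g x).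
Proof.
move=> oU /Ck1P[df cf] /Ck1P[dg cg].
apply: (Ck1_intro _ _ (fun v x => 'D_v f x + 'D_v g x)) => //.
- by move=> x Ux; apply: differentiableD; [exact: df | exact: dg].
- move=> v x Ux; have := @deriveD _ _ _ f g x v; apply; apply: diff_derivable;
    [exact: df | exact: dg].
- by move=> v x Ux; apply: continuousD; [exact: cf | exact: cg].
Qed.

Lemma Ck1_sum {V W : normedModType R} (U : set V) n (f : 'I_n -> V -> W) : open U ->
  (forall i, Ck 1 U (f i)) -> Ck 1 U (fun x => \sum_i f i x).
Proof.
move=> oU; elim: n f => [|n IHn] f hf.
  rewrite (_ : (fun _ => _) = (fun _ => 0)); first exact: Ck1_cst.
  by apply/funext => x; rewrite big_ord0.
rewrite (_ : (fun _ => _) = (fun x => f ord0 x + \sum_i f (lift ord0 i) x)).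
  by apply: Ck1D => //; exact: IHn.
by apply/funext => x; rewrite big_ord_recl.
Qed.

Lemma Ck1M {V : normedModType R} (U : set V) (f g : V -> R) : open U ->
  Ck 1 U f -> Ck 1 U g -> Ck 1 U (fun x => f x * g x).
Proof.
move=> oU /Ck1P[df cf] /Ck1P[dg cg].
apply: (Ck1_intro _ _ (fun v x => f x * 'D_v g x + g x * 'D_v f x)) => //.
- by move=> x Ux; apply: differentiableM; [exact: df | exact: dg].
- move=> v x Ux; have := @deriveM _ _ f g x v; apply; apply: diff_derivable;
    [exact: df | exact: dg].
- move=> v x Ux.
  have cfx : {for x, continuous f} := differentiable_continuous (df x Ux).
  have cgx : {for x, continuous g} := differentiable_continuous (dg x Ux).
  by apply: continuousD;
    [exact: (continuousM cfx (cg v x Ux)) | exact: (continuousM cgx (cf v x Ux))].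
Qed.

Lemma Ck1Zl {V W : normedModType R} (U : set V) (f : V -> R) (w : W) : open U ->
  Ck 1 U f -> Ck 1 U (fun x => f x *: w).
Proof.
move=> oU /Ck1P[df cf].
apply: (Ck1_intro _ _ (fun v x => 'D_v f x *: w)) => //.
- by move=> x Ux; apply: differentiableZl; exact: df.
- move=> v x Ux; rewrite !deriveE ?diffZl //; first exact: df.
    exact: df.
  by apply: differentiableZl; exact: df.
- by move=> v x Ux; apply: cvgZr_tmp; exact: cf.
Qed.

Lemma Ck1_comp_real {V : normedModType R} (U : set V) (f : V -> R) (h dh : R -> R) :
  open U -> Ck 1 U f ->
  (forall x, U x -> is_derive (f x) 1 h (dh (f x))) ->
  (forall x, U x -> {for f x, continuous dh}) ->
  Ck 1 U (fun x => h (f x)).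
Proof.
move=> oU /Ck1P[df cf] dhE cdh.
have dh' x : U x -> differentiable h (f x).
  by move=> /dhE[dx _]; apply/derivable1_diffP.
apply: (Ck1_intro _ _ (fun v x => 'D_v f x * dh (f x))) => //.
- by move=> x Ux; apply: (differentiable_comp (df x Ux)); exact: dh'.
- move=> v x Ux; have dfx : is_derive x v f ('D_v f x).
    by apply/derivableP; apply: diff_derivable; exact: df.
  by have [_ ->] := derive_comp_real f h x v _ _ (df x Ux) dfx (dhE x Ux).
- move=> v x Ux; apply: continuousM; first exact: cf.
  apply: (@continuous_comp _ _ _ f dh); last exact: cdh.
  by apply: differentiable_continuous; exact: df.
Qed.

Lemma Ck1_coord m (U : set 'rV[R]_m) i : Ck 1 U (fun x : 'rV[R]_m => x 0 i).
Proof.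
have dc x : differentiable (fun x : 'rV[R]_m => x 0 i : R) x.
  exact: differentiable_coord.
split=> [x _|v x _]; first exact: dc.
rewrite (_ : (fun y => 'D_v _ y) = cst (v 0 i)); first exact: cst_continuous.
apply/funext => y.
by have [_ ->] := is_derive_coord m y v i.
Qed.

Lemma derive_sum_basis m {W : normedModType R} (F : 'rV[R]_m -> W) (x v : 'rV[R]_m) :
  differentiable F x ->
  'D_v F x = \sum_i v 0 i *: 'D_(delta_mx 0 i) F x.
Proof.
move=> dF; rewrite deriveE // [in LHS](row_sum_delta v) linear_sum.
by apply: eq_bigr => i _; rewrite linearZ deriveE.
Qed.

Lemma Ck1_comp m {V W : normedModType R} (U : set V) (U' : set 'rV[R]_m)
    (g : V -> 'rV[R]_m) (F : 'rV[R]_m -> W) : open U ->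
  (forall x, U x -> U' (g x)) -> Ck 1 U g -> Ck 1 U' F ->
  Ck 1 U (fun x => F (g x)).
Proof.
move=> oU UU' /Ck1P[dg cg] /Ck1P[dF cF].
have dFg x : U x -> differentiable (F \o g) x.
  by move=> Ux; apply: differentiable_comp; [exact: dg | apply: dF; exact: UU'].
apply: (Ck1_intro _ _ (fun v x => \sum_i ('D_v g x) 0 i *: 'D_(delta_mx 0 i) F (g x))) => //.
- move=> v x Ux; rewrite -derive_sum_basis; last by apply: dF; exact: UU'.
  have E : 'd (F \o g) x = 'd F (g x) \o 'd g x :> (V -> W).
    by apply: diff_comp; [exact: dg | apply: dF; exact: UU'].
  transitivity ('d (F \o g) x v); first exact: (deriveE _ (dFg x Ux)).
  by rewrite E /= (deriveE _ (dg x Ux)) (deriveE _ (dF _ (UU' x Ux))).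
- move=> v x Ux; apply: continuous_lam_sum => i; apply: cvgZ.
    apply: (@continuous_comp _ _ _ (fun y => 'D_v g y) (fun M : 'rV[R]_m => M 0 i)).
      exact: cg.
    exact: coord_continuous.
  apply: (@continuous_comp _ _ _ g (fun y => 'D_(delta_mx 0 i) F y)).
    by apply: differentiable_continuous; exact: dg.
  by apply: cF; exact: UU'.
Qed.

End C1.

(** * The sphere and the radial projection *)

Section Sphere.
Context {R : realType}.
Notation V := 'rV[R]_3.
Implicit Types (p u v x : V).

Definition i0 : 'I_3 := @Ordinal 3 0 isT.
Definition i1 : 'I_3 := @Ordinal 3 1 isT.
Definition i2 : 'I_3 := @Ordinal 3 2 isT.

Lemma sum3 {W : zmodType} (F : 'I_3 -> W) : \sum_i F i = F i0 + F i1 + F i2.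
Proof.
rewrite !big_ord_recl big_ord0 addr0 addrA.
by congr (F _ + F _ + F _); apply: val_inj.
Qed.

Lemma ord3P (P : 'I_3 -> Prop) : P i0 -> P i1 -> P i2 -> forall i, P i.
Proof.
move=> h0 h1 h2 [[|[|[|m]]] hm] //.
- by rewrite (_ : Ordinal hm = i0) //; exact: val_inj.
- by rewrite (_ : Ordinal hm = i1) //; exact: val_inj.
- by rewrite (_ : Ordinal hm = i2) //; exact: val_inj.
Qed.

Lemma dotE u v : dot u v = u 0 i0 * v 0 i0 + u 0 i1 * v 0 i1 + u 0 i2 * v 0 i2.
Proof. by rewrite /dot sum3. Qed.

Definition punctured : set V := [set x | x != 0].

Lemma open_punctured : open punctured.
Proof.
have -> : punctured = ~` [set 0].
  by apply/seteqP; split => x /= /eqP.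
rewrite openC; apply: accessible_closed_set1; apply: hausdorff_accessible.
exact: norm_hausdorff.
Qed.

Lemma dot_gt0 {x} : x != 0 -> 0 < dot x x.
Proof.
move=> x0; rewrite lt_def; apply/andP; split; last first.
  by rewrite /dot sumr_ge0 // => i _; rewrite -expr2 sqr_ge0.
apply: contraNneq x0 => xx; apply/eqP/rowP => i; rewrite mxE.
apply: (sum_sqr_eq0 _ (fun i => x 0 i)); rewrite (_ : \sum_i _ = dot x x) ?xx //.
Qed.

Lemma sphere_neq0 {p} : sphere p -> p != 0.
Proof.
move=> sp; apply/eqP => p0; move: sp; rewrite /sphere /= p0 dotE !mxE.
by rewrite !mul0r !addr0 => /eqP; rewrite eq_sym oner_eq0.
Qed.

Lemma radial_id {p} : sphere p -> radial p = p.
Proof. by rewrite /sphere /radial /= => ->; rewrite sqrtr1 invr1 scale1r. Qed.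

Lemma sphere_radial {x} : x != 0 -> sphere (radial x).
Proof.
move=> /dot_gt0 x0; rewrite /sphere /radial /= dotE !mxE.
set s := (Num.sqrt _)^-1.
rewrite (_ : _ + _ = s ^+ 2 * dot x x); last by rewrite dotE; ring.
by rewrite /s exprVn sqr_sqrtr ?(ltW x0) // mulVf // gt_eqF.
Qed.

Lemma Ck1_dot : Ck 1 punctured (fun x : V => dot x x).
Proof.
apply: Ck1_sum; first exact: open_punctured.
by move=> i; apply: Ck1M; [exact: open_punctured | exact: Ck1_coord..].
Qed.

Lemma is_derive_invsqrt (t : R) : 0 < t ->
  is_derive t 1 (fun t => (Num.sqrt t)^-1) (- (Num.sqrt t * Num.sqrt t)^-1 * (2 * Num.sqrt t)^-1).
Proof.
move=> t0; have st : Num.sqrt t != 0 by rewrite gt_eqF // sqrtr_gt0.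
have [d e] := is_derive1_sqrt t0.
apply: DeriveDef; first exact: derivableV.
have := @deriveV _ _ (@Num.sqrt R) t 1 st d.
by rewrite e.
Qed.

Lemma continuous_dinvsqrt (t : R) : 0 < t ->
  {for t, continuous (fun t : R => - (Num.sqrt t * Num.sqrt t)^-1 * (2 * Num.sqrt t)^-1)}.
Proof.
move=> t0; have st : Num.sqrt t != 0 by rewrite gt_eqF // sqrtr_gt0.
have cs : Num.sqrt x @[x --> t] --> Num.sqrt t by exact: sqrt_continuous.
apply: cvgM.
  apply: cvgN; apply: cvgV; first by rewrite mulf_neq0.
  by apply: cvgM.
apply: cvgV; first by rewrite mulf_neq0 // pnatr_eq0.
by apply: cvgM; [exact: cvg_cst | exact: cs].
Qed.

Lemma Ck1_invnorm : Ck 1 punctured (fun x : V => (Num.sqrt (dot x x))^-1).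
Proof.
pose h (t : R) := (Num.sqrt t)^-1.
pose dh (t : R) := - (Num.sqrt t * Num.sqrt t)^-1 * (2 * Num.sqrt t)^-1.
have h1 x : punctured x -> is_derive (dot x x) 1 h (dh (dot x x)).
  by move=> /dot_gt0; exact: is_derive_invsqrt.
have h2 x : punctured x -> {for dot x x, continuous dh}.
  by move=> /dot_gt0; exact: continuous_dinvsqrt.
exact: (Ck1_comp_real _ (fun x : V => dot x x) h dh open_punctured Ck1_dot h1 h2).
Qed.

Lemma Ck1_row m {W : normedModType R} (U : set W) (F : W -> 'rV[R]_m) : open U ->
  (forall i, Ck 1 U (fun y : W => F y 0 i)) -> Ck 1 U F.
Proof.
move=> oU cF; rewrite (_ : F = (fun y : W => \sum_i F y 0 i *: delta_mx 0 i)).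
  by apply: Ck1_sum => // i; exact: Ck1Zl.
by apply/funext => y; rewrite -row_sum_delta.
Qed.

Lemma Ck1_component m {W : normedModType R} (U : set W) (F : W -> 'rV[R]_m) i :
  open U -> Ck 1 U F -> Ck 1 U (fun y : W => F y 0 i).
Proof.
move=> oU cF; apply: (Ck1_comp _ U setT F (fun M : 'rV[R]_m => M 0 i)) => //.
exact: Ck1_coord.
Qed.

Lemma Ck1_radial : Ck 1 punctured (@radial R).
Proof.
apply: Ck1_row => [|i]; first exact: open_punctured.
rewrite (_ : (fun x => _) = (fun x : V => (Num.sqrt (dot x x))^-1 * x 0 i)).
  by apply: Ck1M; [exact: open_punctured | exact: Ck1_invnorm | exact: Ck1_coord].
by apply/funext => x; rewrite !mxE.
Qed.

(** The length is stationary in tangent directions, so the radial projection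
    moves p + t v as the identity does, to first order. *)
Lemma derive_radial {p v} : sphere p -> tangent p v -> 'D_v (@radial R) p = v.
Proof.
move=> sp tv; have p0 := sphere_neq0 sp.
have [dr _] := Ck1P.1 Ck1_radial.
have [dd _] := Ck1P.1 Ck1_dot.
have dp : dot p p = 1 by [].
have ddot : is_derive p v (fun x : V => dot x x) 0.
  have h := is_derive_lam_sum 3 _ p v _ (fun i =>
    is_derive_lamM (is_derive_coord 3 p v i) (is_derive_coord 3 p v i)).
  apply: (is_derive_eq h); have := tv; rewrite /tangent /= dotE sum3 => tv'.
  by rewrite -[RHS](addr0 0) -{1}tv' -tv'; ring.
have dn : is_derive p v (fun x : V => (Num.sqrt (dot x x))^-1) 0.
  have d1 := is_derive_invsqrt _ (dot_gt0 p0).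
  have h := derive_comp_real (fun x : V => dot x x) (fun t => (Num.sqrt t)^-1) _ _ _ _
    (dd p p0) ddot d1.
  by apply: (is_derive_eq h); rewrite mul0r.
apply/rowP => i.
have [_ <-] := derive_coord _ (@radial R) p v i (dr p p0).
have h := is_derive_lamM dn (is_derive_coord 3 p v i).
have E : (fun y : V => radial y 0 i) = (fun y => (Num.sqrt (dot y y))^-1 * y 0 i).
  by apply/funext => y; rewrite mxE.
by rewrite E; have [_ ->] := h; rewrite dp sqrtr1 invr1 mul0r add0r mul1r.
Qed.

(** A local smooth extension composed with the radial projection no longer
    depends on the extension. *)
Lemma smooth_Ck1 {W : normedModType R} (f : V -> W) :
  smooth_on_sphere f -> Ck 1 punctured (fun x => f (radial x)).
Proof.
move=> sf; have [dr _] := Ck1P.1 Ck1_radial.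
suff H x : punctured x -> exists2 U' : set V, U' x & Ck 1 U' (fun x => f (radial x)).
  by split=> [x /H[U' U'x [df _]]|v x /H[U' U'x [_ cf]]]; [exact: df | exact: cf].
move=> x0; have [U [F [oU Ux /(_ 1%N) cF Ff]]] := sf _ (sphere_radial x0).
pose U' := punctured `&` [set y | U (radial y)].
have oU' : open U'.
  rewrite openE => y [y0 Uy]; apply: filterI.
    by apply: open_nbhs_nbhs; split; [exact: open_punctured | exact: y0].
  have c : {for y, continuous (@radial R)} := differentiable_continuous (dr y y0).
  by apply: c; apply: open_nbhs_nbhs; split.
exists U'; first by split.
apply: (Ck1_ext _ (fun x => F (radial x)) _ oU').
  by move=> y [y0 Uy]; apply: Ff => //; exact: sphere_radial.
apply: (Ck1_comp _ U' U _ _ oU') => //; first by move=> y [].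
have [_ cr] := Ck1P.1 Ck1_radial.
by split=> [y [y0 _]|v y [y0 _]]; [exact: dr | exact: cr].
Qed.

End Sphere.

(** * Two-forms on the sphere *)

Section Area.
Context {R : realType}.
Notation V := 'rV[R]_3.
Implicit Types (p u v x : V).

Definition det3 u v x : R :=
  u 0 i0 * (v 0 i1 * x 0 i2 - v 0 i2 * x 0 i1)
  - u 0 i1 * (v 0 i0 * x 0 i2 - v 0 i2 * x 0 i0)
  + u 0 i2 * (v 0 i0 * x 0 i1 - v 0 i1 * x 0 i0).

(** The infinitesimal rotation p |-> e_k x p, written as a matrix product in
    order to be visibly smooth. *)
Definition rot (k : 'I_3) p : V :=
  p *m \matrix_(i, j) det3 (delta_mx 0 k) (delta_mx 0 i) (delta_mx 0 j).

Lemma rotE p :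
  (((rot i0 p) 0 i0 = 0) * ((rot i0 p) 0 i1 = - p 0 i2) * ((rot i0 p) 0 i2 = p 0 i1)) *
  (((rot i1 p) 0 i0 = p 0 i2) * ((rot i1 p) 0 i1 = 0) * ((rot i1 p) 0 i2 = - p 0 i0)) *
  (((rot i2 p) 0 i0 = - p 0 i1) * ((rot i2 p) 0 i1 = p 0 i0) * ((rot i2 p) 0 i2 = 0)).
Proof. by do ![split]; rewrite /rot !mxE sum3 !mxE /det3 !mxE /=; ring. Qed.

Lemma Ck_cst {W W' : normedModType R} k (U : set W) (c : W') : Ck k U (fun _ => c).
Proof.
elim: k c => [|k IHk] c; first by move=> x _; exact: cst_continuous.
split=> [x _|v]; first exact: differentiable_cst.
rewrite (_ : (fun y => 'D_v _ y) = (fun _ => 0)); first exact: IHk.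
by apply/funext => y; exact: derive_cst.
Qed.

Lemma Ck_mulmx k m n (A : 'M[R]_(m, n)) : Ck k setT (fun p : 'rV[R]_m => p *m A).
Proof.
have c1 : Ck 1 setT (fun p : 'rV[R]_m => p *m A).
  apply: Ck1_row => [|j]; first exact: openT.
  rewrite (_ : (fun y => _) = (fun y : 'rV[R]_m => \sum_i y 0 i * A i j)).
    apply: Ck1_sum => [|i]; first exact: openT.
    by apply: Ck1M; [exact: openT | exact: Ck1_coord | exact: Ck1_cst].
  by apply/funext => y; rewrite mxE.
have [dA _] := Ck1P.1 c1.
case: k => [|k]; first by move=> x _; exact: differentiable_continuous (dA x I).
split=> // v; rewrite (_ : (fun y => 'D_v _ y) = (fun _ => v *m A)); first exact: Ck_cst.
apply/funext => y; apply/rowP => j.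
have [_ <-] := derive_coord _ (fun p : 'rV[R]_m => p *m A) y v j (dA y I).
have [_ E] := is_derive_lam_sum m _ y v _ (fun i =>
  is_derive_lamM (is_derive_coord m y v i) (is_derive_cst (A i j) y v)).
rewrite mxE.
rewrite (_ : (fun y => _) = (fun y : 'rV[R]_m => \sum_i y 0 i * A i j)); last first.
  by apply/funext => z; rewrite mxE.
by rewrite E; apply: eq_bigr => i _; rewrite mulr0 addr0.
Qed.

Lemma vector_field_rot k : vector_field (rot k).
Proof.
split=> [p _|p _].
  rewrite /tangent /= dotE.
  by move: k; apply: ord3P; rewrite !rotE; ring.
exists setT, (rot k); split=> //; first exact: openT.
by move=> m; exact: Ck_mulmx.
Qed.

Lemma tangent_rot k p : sphere p -> tangent p (rot k p).
Proof. by have [H _] := vector_field_rot k; exact: H. Qed.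

Lemma comb3E a b c (x y z : V) i :
  (a *: x + (b *: y + (c *: z + 0))) 0 i = a * x 0 i + (b * y 0 i + c * z 0 i).
Proof. by rewrite !mxE addr0. Qed.

(** On the sphere u = (p x u) x p for tangent u. *)
Lemma tangent_rot_decomp p u : sphere p -> tangent p u ->
  u = (p 0 i1 * u 0 i2 - p 0 i2 * u 0 i1) *: rot i0 p
    + ((p 0 i2 * u 0 i0 - p 0 i0 * u 0 i2) *: rot i1 p
    + ((p 0 i0 * u 0 i1 - p 0 i1 * u 0 i0) *: rot i2 p + 0)).
Proof.
rewrite /sphere /tangent /= => pp pu; apply/rowP.
have E a b : a = a * dot p p - b * dot p u by rewrite pp pu; ring.
apply: ord3P; rewrite comb3E !rotE.
- by rewrite [LHS](E _ (p 0 i0)) !dotE; ring.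
- by rewrite [LHS](E _ (p 0 i1)) !dotE; ring.
- by rewrite [LHS](E _ (p 0 i2)) !dotE; ring.
Qed.

Section Form.
Variable w : V -> V -> V -> R.
Hypothesis hw : two_form w.

(** The ratio of w to the area form.  The area form takes the value p_k on the
    two rotations other than the k-th one, and the sum of the p_k ^ 2 is 1. *)
Definition density p : R :=
  p 0 i0 * w p (rot i1 p) (rot i2 p) + p 0 i1 * w p (rot i2 p) (rot i0 p)
  + p 0 i2 * w p (rot i0 p) (rot i1 p).

Lemma two_form_linl p a u u' v : sphere p -> tangent p u -> tangent p u' ->
  tangent p v -> w p (a *: u + u') v = a * w p u v + w p u' v.
Proof. by have [H _ _] := hw; exact: H. Qed.

Lemma two_form_anti p u v : sphere p -> tangent p u -> tangent p v ->
  w p u v = - w p v u.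
Proof. by have [_ H _] := hw; exact: H. Qed.

Lemma tangent0 p : tangent p 0.
Proof. by rewrite /tangent /= dotE !mxE; ring. Qed.

Lemma tangentD p a u v : tangent p u -> tangent p v -> tangent p (a *: u + v).
Proof.
rewrite /tangent /= => pu pv.
have -> : dot p (a *: u + v) = a * dot p u + dot p v.
  by rewrite !dotE !mxE; ring.
by rewrite pu pv mulr0 addr0.
Qed.

Lemma two_form_alt p u : sphere p -> tangent p u -> w p u u = 0.
Proof. by move=> sp tu; have := two_form_anti p u u sp tu tu; lra. Qed.

Lemma two_form_0l p v : sphere p -> tangent p v -> w p 0 v = 0.
Proof.
move=> sp tv; have := two_form_linl p 1 0 0 v sp (tangent0 p) (tangent0 p) tv.
by rewrite scaler0 addr0; lra.
Qed.

(** Expanding u and v on the rotations leaves the scalar product of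
    (p x u) x (p x v) = det(p, u, v) p with the vector of the values of w on
    pairs of rotations. *)
Lemma two_form_area p u v : sphere p -> tangent p u -> tangent p v ->
  w p u v = density p * det3 p u v.
Proof.
move=> sp tu tv.
have tr k := tangent_rot k p sp.
have expand x y : tangent p x -> tangent p y -> w p x y =
    (p 0 i1 * x 0 i2 - p 0 i2 * x 0 i1) * w p (rot i0 p) y
  + (p 0 i2 * x 0 i0 - p 0 i0 * x 0 i2) * w p (rot i1 p) y
  + (p 0 i0 * x 0 i1 - p 0 i1 * x 0 i0) * w p (rot i2 p) y.
  move=> tx ty; rewrite [in LHS](tangent_rot_decomp _ _ sp tx).
  have t2 := tangentD p (p 0 i0 * x 0 i1 - p 0 i1 * x 0 i0) _ _ (tr i2) (tangent0 p).
  have t1 := tangentD p (p 0 i2 * x 0 i0 - p 0 i0 * x 0 i2) _ _ (tr i1) t2.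
  rewrite two_form_linl // two_form_linl // two_form_linl //; last exact: tangent0.
  by rewrite two_form_0l //; ring.
have expandr k : w p (rot k p) v = - (
    (p 0 i1 * v 0 i2 - p 0 i2 * v 0 i1) * w p (rot i0 p) (rot k p)
  + (p 0 i2 * v 0 i0 - p 0 i0 * v 0 i2) * w p (rot i1 p) (rot k p)
  + (p 0 i0 * v 0 i1 - p 0 i1 * v 0 i0) * w p (rot i2 p) (rot k p)).
  by rewrite two_form_anti // expand.
rewrite expand // !expandr !(two_form_alt p (rot _ p)) //.
rewrite (two_form_anti p (rot i1 p) (rot i0 p)) // (two_form_anti p (rot i2 p) (rot i1 p)) //.
rewrite (two_form_anti p (rot i0 p) (rot i2 p)) //.
rewrite /density; move: (w p _ _) (w p _ _) (w p _ _) => w01 w20 w12.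
by rewrite /det3; ring.
Qed.

Lemma Ck1_density : Ck 1 (@punctured R) (fun x => density (radial x)).
Proof.
have oP := @open_punctured R.
have cr i : Ck 1 (@punctured R) (fun x : V => radial x 0 i).
  by apply: Ck1_component => //; exact: Ck1_radial.
have cw k l : Ck 1 (@punctured R) (fun x => w (radial x) (rot k (radial x)) (rot l (radial x))).
  apply: (smooth_Ck1 (fun p => w p (rot k p) (rot l p))).
  by have [_ _ H] := hw; apply: H; exact: vector_field_rot.
by apply: Ck1D => //; [apply: Ck1D => // |]; apply: Ck1M.
Qed.

End Form.
End Area.

Section Det3.
Context {R : realType}.
Notation V := 'rV[R]_3.
Implicit Types (p u v z : V).

Lemma is_derive_det3 {W : normedModType R} (A B C : W -> V) (x h : W) (A' B' C' : V) :
  (forall i, is_derive x h (fun y => A y 0 i) (A' 0 i)) ->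
  (forall i, is_derive x h (fun y => B y 0 i) (B' 0 i)) ->
  (forall i, is_derive x h (fun y => C y 0 i) (C' 0 i)) ->
  is_derive x h (fun y => det3 (A y) (B y) (C y))
    (det3 A' (B x) (C x) + det3 (A x) B' (C x) + det3 (A x) (B x) C').
Proof.
move=> dA dB dC.
have m2 i j := is_derive_lamB
  (is_derive_lamM (dB i) (dC j))
  (is_derive_lamM (dB j) (dC i)).
have m3 k i j := is_derive_lamM (dA k) (m2 i j).
have h3 := is_derive_lamD
  (is_derive_lamB (m3 i0 i1 i2) (m3 i1 i0 i2)) (m3 i2 i0 i1).
by apply: (is_derive_eq h3); rewrite /det3; ring.
Qed.

(** The tangent plane is two-dimensional. *)
Lemma det3_tangent p u v z : sphere p -> tangent p u -> tangent p v -> tangent p z ->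
  det3 u v z = 0.
Proof.
rewrite /sphere /tangent /= => pp pu pv pz.
have -> : det3 u v z = det3 u v z * dot p p by rewrite pp mulr1.
rewrite (_ : det3 u v z * dot p p = dot p u * det3 p v z + dot p v * det3 u p z +
  dot p z * det3 u v p); last by rewrite !dotE /det3; ring.
by rewrite pu pv pz !mul0r !addr0.
Qed.

Lemma det3_lin p u a v z : det3 p u (a *: v + z) = a * det3 p u v + det3 p u z.
Proof. by rewrite /det3 !mxE; ring. Qed.

Lemma det3_comb p u n (c : 'I_n -> R) (v : 'I_n -> V) :
  det3 p u (\sum_i c i *: v i) = \sum_i c i * det3 p u (v i).
Proof.
elim: n c v => [|n IHn] c v; first by rewrite !big_ord0 /det3 !mxE; ring.
by rewrite !big_ord_recl det3_lin IHn.
Qed.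

Lemma det3_swap p u v : det3 p u v = - det3 p v u.
Proof. by rewrite /det3; ring. Qed.

(** The quadratic relation among the minors of four vectors of the plane,
    here the quotient of the space by the line of p. *)
Lemma det3_pluecker p u v a b :
  det3 p u a * det3 p v b - det3 p v a * det3 p u b = det3 p u v * det3 p a b.
Proof. by rewrite /det3; ring. Qed.

Lemma derive_linear {W : normedModType R} (F : V -> W) p a u v :
  differentiable F p -> 'D_(a *: u + v) F p = a *: 'D_u F p + 'D_v F p.
Proof. by move=> dF; rewrite !deriveE // linearP. Qed.

(** A three-form on the tangent plane vanishes, here the exterior product of
    the differential of F with the area form. *)
Lemma derive_cyclic (F : V -> R) p u v z : differentiable F p ->
  sphere p -> tangent p u -> tangent p v -> tangent p z ->
  'D_u F p * det3 p v z - 'D_v F p * det3 p u z = - ('D_z F p * det3 p u v).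
Proof.
move=> dF sp tu tv tz.
have E : det3 p v z *: u + (- det3 p u z *: v + (det3 p u v *: z + 0)) = 0.
  apply/rowP => i; rewrite comb3E mxE.
  transitivity (p 0 i * det3 u v z); last by rewrite (det3_tangent p) // mulr0.
  by move: i; apply: ord3P; rewrite /det3; ring.
have := derive0 F p; rewrite -E !derive_linear // derive0 /GRing.scale /=; lra.
Qed.

End Det3.

(** * Spherical coordinates *)

Section Curves.
Context {R : realType}.
Notation V := 'rV[R]_3.
Implicit Types (x y t : R).

Definition vec (a b c : R) : V := \row_(i < 3) nth 0 [:: a; b; c] i.

Lemma vecE a b c : ((vec a b c 0 i0 = a) * (vec a b c 0 i1 = b)) * (vec a b c 0 i2 = c).
Proof. by rewrite !mxE. Qed.

(** Spherical coordinates with longitude x and colatitude y; both range over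
    the whole line, the poles being the lines sin y = 0.  Then the partial
    derivatives in x and in y, and the mixed one. *)
Definition Psi x y : V := vec (sin y * cos x) (sin y * sin x) (cos y).
Definition Psix x y : V := vec (- (sin y * sin x)) (sin y * cos x) 0.
Definition Psiy x y : V := vec (cos y * cos x) (cos y * sin x) (- sin y).
Definition Psixy x y : V := vec (- (cos y * sin x)) (cos y * cos x) 0.

Lemma sphere_Psi x y : sphere (Psi x y).
Proof.
rewrite /sphere /= dotE !vecE.
have h1 := cos2Dsin2 x; have h2 := cos2Dsin2 y.
rewrite -[RHS]h2 -[sin y ^+ 2]mulr1 -h1; ring.
Qed.

Lemma tangent_Psix x y : tangent (Psi x y) (Psix x y).
Proof. by rewrite /tangent /= dotE !vecE; ring. Qed.

Lemma tangent_Psiy x y : tangent (Psi x y) (Psiy x y).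
Proof.
rewrite /tangent /= dotE !vecE.
transitivity (sin y * cos y * (cos x ^+ 2 + sin x ^+ 2) - sin y * cos y); first by ring.
by rewrite cos2Dsin2; ring.
Qed.

Section Derivatives.
Variables x y : R.

Lemma is_derive_Psi_x i : is_derive x 1 (fun x => Psi x y 0 i) (Psix x y 0 i).
Proof.
move: i; apply: ord3P; rewrite vecE.
- rewrite (_ : (fun _ => _) = (fun x => sin y * cos x)); last by apply/funext => z; rewrite vecE.
  have h := is_derive_lamM (is_derive_cst (sin y) x 1) (is_derive_cos x).
  by apply: (is_derive_eq h); rewrite /cst; ring.
- rewrite (_ : (fun _ => _) = (fun x => sin y * sin x)); last by apply/funext => z; rewrite vecE.
  have h := is_derive_lamM (is_derive_cst (sin y) x 1) (is_derive_sin x).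
  by apply: (is_derive_eq h); rewrite /cst; ring.
- rewrite (_ : (fun _ => _) = (fun x => cos y)); last by apply/funext => z; rewrite vecE.
  exact: is_derive_cst.
Qed.

Lemma is_derive_Psi_y i : is_derive y 1 (fun y => Psi x y 0 i) (Psiy x y 0 i).
Proof.
move: i; apply: ord3P; rewrite vecE.
- rewrite (_ : (fun _ => _) = (fun y => sin y * cos x)); last by apply/funext => z; rewrite vecE.
  have h := is_derive_lamM (is_derive_sin y) (is_derive_cst (cos x) y 1).
  by apply: (is_derive_eq h); rewrite /cst; ring.
- rewrite (_ : (fun _ => _) = (fun y => sin y * sin x)); last by apply/funext => z; rewrite vecE.
  have h := is_derive_lamM (is_derive_sin y) (is_derive_cst (sin x) y 1).
  by apply: (is_derive_eq h); rewrite /cst; ring.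
- rewrite (_ : (fun _ => _) = (fun y => cos y)); last by apply/funext => z; rewrite vecE.
  exact: is_derive_cos.
Qed.

Lemma is_derive_Psiy_x i : is_derive x 1 (fun x => Psiy x y 0 i) (Psixy x y 0 i).
Proof.
move: i; apply: ord3P; rewrite vecE.
- rewrite (_ : (fun _ => _) = (fun x => cos y * cos x)); last by apply/funext => z; rewrite vecE.
  have h := is_derive_lamM (is_derive_cst (cos y) x 1) (is_derive_cos x).
  by apply: (is_derive_eq h); rewrite /cst; ring.
- rewrite (_ : (fun _ => _) = (fun x => cos y * sin x)); last by apply/funext => z; rewrite vecE.
  have h := is_derive_lamM (is_derive_cst (cos y) x 1) (is_derive_sin x).
  by apply: (is_derive_eq h); rewrite /cst; ring.
- rewrite (_ : (fun _ => _) = (fun x => - sin y)); last by apply/funext => z; rewrite vecE.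
  exact: is_derive_cst.
Qed.

Lemma is_derive_Psix_y i : is_derive y 1 (fun y => Psix x y 0 i) (Psixy x y 0 i).
Proof.
move: i; apply: ord3P; rewrite vecE.
- rewrite (_ : (fun _ => _) = (fun y => sin y * - sin x)); last by apply/funext => z; rewrite vecE; ring.
  have h := is_derive_lamM (is_derive_sin y) (is_derive_cst (- sin x) y 1).
  by apply: (is_derive_eq h); rewrite /cst; ring.
- rewrite (_ : (fun _ => _) = (fun y => sin y * cos x)); last by apply/funext => z; rewrite vecE.
  have h := is_derive_lamM (is_derive_sin y) (is_derive_cst (cos x) y 1).
  by apply: (is_derive_eq h); rewrite /cst; ring.
- rewrite (_ : (fun _ => _) = (fun y => 0)); last by apply/funext => z; rewrite vecE.
  exact: is_derive_cst.
Qed.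

End Derivatives.

Lemma chain_rule m (c : R -> 'rV[R]_m) (c' : 'rV[R]_m) (t : R) (F : 'rV[R]_m -> R) :
  (forall i, is_derive t 1 (fun t => c t 0 i) (c' 0 i)) ->
  differentiable F (c t) -> is_derive t 1 (fun t => F (c t)) ('D_c' F (c t)).
Proof.
move=> dc dF.
have dct : derivable c t 1.
  by apply/derivable_mxP => i j; rewrite (ord1 i); have [] := dc j.
have dct' : differentiable c t by apply/derivable1_diffP.
have dFc : differentiable (F \o c) t by exact: differentiable_comp.
have E : 'd (F \o c) t = 'd F (c t) \o 'd c t :> (R -> R) by exact: diff_comp.
apply: DeriveDef; first by apply: diff_derivable; exact: dFc.
transitivity ('d (F \o c) t 1); first exact: (deriveE _ dFc).
rewrite E /= -(deriveE _ dct') -(deriveE _ dF); congr ('D__ _ _).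
apply/rowP => i; rewrite (derive_mx dct) mxE.
by have [_ ->] := dc i.
Qed.

Definition cont2 (h : R -> R -> R) := continuous (fun z : R * R => h z.1 z.2).
Definition cont2V m (A : R -> R -> 'rV[R]_m) := forall i, cont2 (fun x y => A x y 0 i).

Lemma cont2_cst c : cont2 (fun _ _ => c).
Proof. by move=> z; exact: cst_continuous. Qed.

Lemma cont2D h k : cont2 h -> cont2 k -> cont2 (fun x y => h x y + k x y).
Proof.
move=> ch ck z; apply: (@continuousD R R _ (fun z => h z.1 z.2) (fun z => k z.1 z.2));
  [exact: ch | exact: ck].
Qed.

Lemma cont2M h k : cont2 h -> cont2 k -> cont2 (fun x y => h x y * k x y).
Proof.
move=> ch ck z; apply: (@continuousM R _ (fun z => h z.1 z.2) (fun z => k z.1 z.2));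
  [exact: ch | exact: ck].
Qed.

Lemma cont2N h : cont2 h -> cont2 (fun x y => - h x y).
Proof.
move=> ch z; apply: (@continuousN R R _ (fun z => h z.1 z.2)); exact: ch.
Qed.

Lemma cont2B h k : cont2 h -> cont2 k -> cont2 (fun x y => h x y - k x y).
Proof. by move=> ch ck; apply: cont2D => //; exact: cont2N. Qed.

Lemma cont2_sum n (h : 'I_n -> R -> R -> R) : (forall i, cont2 (h i)) ->
  cont2 (fun x y => \sum_i h i x y).
Proof. by move=> ch z; apply: continuous_lam_sum => i; exact: ch. Qed.

Lemma cont2_det3 (A B C : R -> R -> V) : cont2V 3 A -> cont2V 3 B -> cont2V 3 C ->
  cont2 (fun x y => det3 (A x y) (B x y) (C x y)).
Proof.
by move=> cA cB cC; rewrite /det3; apply: cont2D; [apply: cont2B |];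
  apply: cont2M => //; apply: cont2B; apply: cont2M.
Qed.

Lemma cont2_fst (h : R -> R) : continuous h -> cont2 (fun x _ => h x).
Proof.
move=> ch z; apply: (@continuous_comp _ _ _ (fun z : R * R => z.1) h); last exact: ch.
exact: cvg_fst.
Qed.

Lemma cont2_snd (h : R -> R) : continuous h -> cont2 (fun _ y => h y).
Proof.
move=> ch z; apply: (@continuous_comp _ _ _ (fun z : R * R => z.2) h); last exact: ch.
exact: cvg_snd.
Qed.

Lemma cont2V_vec a b c : cont2 a -> cont2 b -> cont2 c ->
  cont2V 3 (fun x y => vec (a x y) (b x y) (c x y)).
Proof.
move=> ca cb cc; apply: ord3P.
- by rewrite /cont2 (_ : (fun _ => _) = (fun z => a z.1 z.2)) //; apply/funext => z; rewrite vecE.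
- by rewrite /cont2 (_ : (fun _ => _) = (fun z => b z.1 z.2)) //; apply/funext => z; rewrite vecE.
- by rewrite /cont2 (_ : (fun _ => _) = (fun z => c z.1 z.2)) //; apply/funext => z; rewrite vecE.
Qed.

Let csin1 : cont2 (fun x _ => sin x). Proof. by apply: cont2_fst; exact: continuous_sin. Qed.
Let csin2 : cont2 (fun _ y => sin y). Proof. by apply: cont2_snd; exact: continuous_sin. Qed.
Let ccos1 : cont2 (fun x _ => cos x). Proof. by apply: cont2_fst; exact: continuous_cos. Qed.
Let ccos2 : cont2 (fun _ y => cos y). Proof. by apply: cont2_snd; exact: continuous_cos. Qed.

Lemma cont2V_Psi : cont2V 3 Psi.
Proof. by apply: cont2V_vec => //; apply: cont2M. Qed.
Lemma cont2V_Psix : cont2V 3 Psix.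
Proof. by apply: cont2V_vec; [apply: cont2N; apply: cont2M | apply: cont2M | exact: cont2_cst]. Qed.
Lemma cont2V_Psiy : cont2V 3 Psiy.
Proof. by apply: cont2V_vec; [apply: cont2M | apply: cont2M | exact: cont2N]. Qed.
Lemma cont2V_Psixy : cont2V 3 Psixy.
Proof. by apply: cont2V_vec; [apply: cont2N; apply: cont2M | apply: cont2M | exact: cont2_cst]. Qed.

Lemma cont2_comp_Psi (G : V -> R) :
  (forall p, sphere p -> {for p, continuous G}) -> cont2 (fun x y => G (Psi x y)).
Proof.
move=> cG z; apply: (@continuous_comp _ _ _ (fun z : R * R => Psi z.1 z.2) G);
  last by apply: cG; exact: sphere_Psi.
rewrite (_ : (fun _ => _) = (fun z : R * R => \sum_i Psi z.1 z.2 0 i *: delta_mx 0 i)).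
  by apply: continuous_lam_sum => i; apply: cvgZr_tmp; exact: cont2V_Psi.
by apply/funext => z'; rewrite -row_sum_delta.
Qed.

End Curves.

(** * Lie algebras and the Yang-Baxter equation *)

Section LieAlgebra.
Context {R : realType}.

Definition j0 : 'I_2 := @Ordinal 2 0 isT.
Definition j1 : 'I_2 := @Ordinal 2 1 isT.

Lemma sum2 {W : zmodType} (F : 'I_2 -> W) : \sum_i F i = F j0 + F j1.
Proof.
by rewrite !big_ord_recl big_ord0 addr0; congr (F _ + F _); apply: val_inj.
Qed.

Lemma det22 (M : 'M[R]_2) : \det M = M j0 j0 * M j1 j1 - M j0 j1 * M j1 j0.
Proof.
have l0 k : lift j0 k = j1 by apply: val_inj; rewrite (ord1 k).
have l1 k : lift j1 k = j0 by apply: val_inj; rewrite (ord1 k).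
rewrite (expand_det_row _ j0) sum2 /cofactor !det_mx11 !mxE /= !l0 !l1.
by rewrite expr0 expr1; ring.
Qed.

Lemma det33 (M : 'M[R]_3) : \det M =
  M i0 i0 * (M i1 i1 * M i2 i2 - M i1 i2 * M i2 i1)
  - M i0 i1 * (M i1 i0 * M i2 i2 - M i1 i2 * M i2 i0)
  + M i0 i2 * (M i1 i0 * M i2 i1 - M i1 i1 * M i2 i0).
Proof.
have l00 : lift i0 j0 = i1 by exact: val_inj.
have l01 : lift i0 j1 = i2 by exact: val_inj.
have l10 : lift i1 j0 = i0 by exact: val_inj.
have l11 : lift i1 j1 = i2 by exact: val_inj.
have l20 : lift i2 j0 = i0 by exact: val_inj.
have l21 : lift i2 j1 = i1 by exact: val_inj.
rewrite (expand_det_row _ i0) sum3 /cofactor !det22 !mxE /=.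
rewrite !(l00, l01, l10, l11, l20, l21) expr0 expr1 expr2.
by ring.
Qed.

Section Wedge.
Variable V : lmodType R.

Lemma wedge2E (x y : V) (a b : V -> R) :
  wedge [:: x; y] [:: a; b] = a x * b y - b x * a y.
Proof.
by rewrite /wedge det22 !mxE /=.
Qed.
End Wedge.
Variable g : lie_algebra R.

Lemma lie_brDl (x y z : g) : lie_br (x + y) z = lie_br x z + lie_br y z.
Proof. by have := lie_br_linearl z 1 x y; rewrite !scale1r. Qed.

Lemma lie_brDr (x y z : g) : lie_br z (x + y) = lie_br z x + lie_br z y.
Proof. by have := lie_br_linearr z 1 x y; rewrite !scale1r. Qed.

Lemma lie_br0l (z : g) : lie_br 0 z = 0.
Proof. by have := lie_br_linearl z (-1) 0 0; rewrite scaler0 addr0 scaleN1r addNr. Qed.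

Lemma lie_br0r (z : g) : lie_br z 0 = 0.
Proof. by have := lie_br_linearr z (-1) 0 0; rewrite scaler0 addr0 scaleN1r addNr. Qed.

Lemma lie_brZl a (x z : g) : lie_br (a *: x) z = a *: lie_br x z.
Proof. by have := lie_br_linearl z a x 0; rewrite !addr0 lie_br0l addr0. Qed.

Lemma lie_brZr a (x z : g) : lie_br z (a *: x) = a *: lie_br z x.
Proof. by have := lie_br_linearr z a x 0; rewrite !addr0 lie_br0r addr0. Qed.

Lemma lie_br_suml n (x : 'I_n -> g) z :
  lie_br (\sum_i x i) z = \sum_i lie_br (x i) z.
Proof.
apply: (big_morph (fun x => lie_br x z)) => [u v|]; [exact: lie_brDl | exact: lie_br0l].
Qed.

Lemma lie_br_sumr n (x : 'I_n -> g) z :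
  lie_br z (\sum_i x i) = \sum_i lie_br z (x i).
Proof.
apply: (big_morph (fun x => lie_br z x)) => [u v|]; [exact: lie_brDr | exact: lie_br0r].
Qed.

Lemma lie_br_anti (x y : g) : lie_br x y = - lie_br y x.
Proof.
have := lie_br_alt (x + y); rewrite lie_brDl !lie_brDr !lie_br_alt add0r addr0.
by move/eqP; rewrite addr_eq0 => /eqP.
Qed.

Lemma lie_brN (x y : g) : lie_br x (- y) = - lie_br x y.
Proof. by rewrite -scaleN1r lie_brZr scaleN1r. Qed.

Lemma lie_br_ad (x y z : g) :
  lie_br (lie_br x y) z = lie_br x (lie_br y z) - lie_br y (lie_br x z).
Proof.
have := lie_br_jacobi x y z.
rewrite (lie_br_anti z (lie_br x y)) (lie_br_anti z x) lie_brN.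
by move/eqP; rewrite subr_eq0 => /eqP ->.
Qed.

End LieAlgebra.

Section YangBaxter.
Context {R : realType}.
Variables (g : lie_algebra R) (n : nat) (E : n.-tuple g) (r : 'M[R]_n).
Hypothesis hE : basis_of fullv E.
Hypothesis hr : r_matrix (tnth E) r.

Let e := tnth E.

Lemma basis_expand (x : g) : x = \sum_k coord E k x *: e k.
Proof.
rewrite [LHS](coord_basis hE (memvf x)); apply: eq_bigr => k _.
by rewrite /e (tnth_nth 0).
Qed.

Lemma coord_tnth k l : coord E k (e l) = (k == l)%:R.
Proof. by rewrite /e (tnth_nth 0) (coord_free l k (basis_free hE)) eq_sym. Qed.

(** The functional whose values on the basis are al.  Functionals are handled
    through these values because the differential equations are written in
    coordinates. *)
Definition ext (al : 'I_n -> R) (x : g) : R := \sum_k coord E k x * al k.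

Lemma ext_basis al k : ext al (e k) = al k.
Proof.
rewrite /ext (bigD1 k) //= coord_tnth eqxx mul1r big1 ?addr0 // => l /negPf lk.
by rewrite coord_tnth lk mul0r.
Qed.

Lemma ext_linear al : linear (ext al : g -> R^o).
Proof.
move=> a x y; rewrite /ext /GRing.scale /= mulr_sumr -big_split /=.
by apply: eq_bigr => k _; rewrite linearP /= mulrDl mulrA.
Qed.

Lemma extD al x y : ext al (x + y) = ext al x + ext al y.
Proof. by have := ext_linear al 1 x y; rewrite scale1r [1 *: _]mul1r. Qed.

Lemma ext_sum al m (x : 'I_m -> g) : ext al (\sum_i x i) = \sum_i ext al (x i).
Proof.
apply: (big_morph (ext al)) => [x' y|]; first exact: extD.
by rewrite /ext big1 // => k _; rewrite linear0 mul0r.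
Qed.

Lemma extZ al a x : ext al (a *: x) = a * ext al x.
Proof.
by rewrite /ext mulr_sumr; apply: eq_bigr => k _; rewrite linearZ /= mulrA.
Qed.

Lemma extN al x : ext al (- x) = - ext al x.
Proof. by rewrite -scaleN1r extZ mulN1r. Qed.

Definition ext_scalar (al : 'I_n -> R) : {scalar g} :=
  HB.pack (ext al : g -> R^o)
    (GRing.isLinear.Build R g R^o *:%R (ext al) (ext_linear al)).

Lemma r_skew i j : r i j = - r j i.
Proof. by have [/matrixP/(_ j i)] := hr; rewrite !mxE. Qed.

(** The j-th coordinate of the contraction of r with the functional be. *)
Definition contr (be : 'I_n -> R) (j : 'I_n) : R := \sum_i r j i * be i.

(** The map g^* -> g defined by r. *)
Definition sharp (be : 'I_n -> R) : g := \sum_j contr be j *: e j.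

Lemma ext_sharp al be : ext al (sharp be) = \sum_i \sum_j r i j * (al i * be j).
Proof.
rewrite /sharp ext_sum; apply: eq_bigr => i _.
rewrite extZ ext_basis /contr mulr_suml; apply: eq_bigr => j _; ring.
Qed.

(** The map defined by r is skew-adjoint. *)
Lemma ext_sharp_skew al be : ext al (sharp be) = - ext be (sharp al).
Proof.
rewrite !ext_sharp exchange_big -sumrN; apply: eq_bigr => i _.
by rewrite -sumrN; apply: eq_bigr => j _; rewrite r_skew; ring.
Qed.

Definition cybe_sum (F : 'I_n -> 'I_n -> 'I_n -> 'I_n -> R) : R :=
  \sum_i \sum_j \sum_k \sum_l r i j * r k l * F i j k l.

Lemma cybe_sumD F G :
  cybe_sum (fun i j k l => F i j k l + G i j k l) = cybe_sum F + cybe_sum G.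
Proof.
rewrite /cybe_sum -big_split; apply: eq_bigr => i _; rewrite -big_split.
apply: eq_bigr => j _; rewrite -big_split; apply: eq_bigr => k _.
by rewrite -big_split; apply: eq_bigr => l _; rewrite mulrDr.
Qed.

Lemma cybe_sumN F : cybe_sum (fun i j k l => - F i j k l) = - cybe_sum F.
Proof.
rewrite /cybe_sum -sumrN; apply: eq_bigr => i _; rewrite -sumrN.
apply: eq_bigr => j _; rewrite -sumrN; apply: eq_bigr => k _.
by rewrite -sumrN; apply: eq_bigr => l _; rewrite mulrN.
Qed.

Lemma eq_cybe_sum F G :
  (forall i j k l, F i j k l = G i j k l) -> cybe_sum F = cybe_sum G.
Proof.
by move=> FG; do 4![apply: eq_bigr => ? _]; rewrite FG.
Qed.

Lemma cybe_sum_swapr F : cybe_sum (fun i j k l => F i j l k) = - cybe_sum F.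
Proof.
rewrite -cybe_sumN /cybe_sum; apply: eq_bigr => i _; apply: eq_bigr => j _.
rewrite exchange_big; apply: eq_bigr => k _; apply: eq_bigr => l _ /=.
by rewrite (r_skew l k); ring.
Qed.

Lemma cybe_sum_swapl F : cybe_sum (fun i j k l => F j i k l) = - cybe_sum F.
Proof.
rewrite -cybe_sumN /cybe_sum exchange_big; apply: eq_bigr => i _; apply: eq_bigr => j _ /=.
apply: eq_bigr => k _; apply: eq_bigr => l _.
by rewrite (r_skew j i); ring.
Qed.

Lemma ext_br_sharp al be ga : ext al (lie_br (sharp be) (sharp ga)) =
  cybe_sum (fun i j k l => ext al (lie_br (e i) (e k)) * (be j * ga l)).
Proof.
rewrite /sharp lie_br_suml ext_sum; apply: eq_bigr => i _.
rewrite lie_brZl extZ lie_br_sumr ext_sum mulr_sumr.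
rewrite exchange_big /=; apply: eq_bigr => k _.
rewrite lie_brZr extZ /contr mulrA !mulr_suml; apply: eq_bigr => j _.
move: (ext al _) => t; rewrite mulr_sumr mulr_suml; apply: eq_bigr => l _.
by ring.
Qed.

Lemma wedge3E (V : lmodType R) (x y z : V) (a b c : V -> R) :
  wedge [:: x; y; z] [:: a; b; c] =
    a x * (b y * c z - c y * b z) - b x * (a y * c z - c y * a z)
    + c x * (a y * b z - b y * a z).
Proof. by rewrite /wedge det33 !mxE. Qed.

Lemma gerstenhaber22E (x y z t : g) a :
  gerstenhaber [:: x; y] [:: z; t] a =
    wedge [:: lie_br x z; y; t] a - wedge [:: lie_br x t; y; z] a
    - wedge [:: lie_br y z; x; t] a + wedge [:: lie_br y t; x; z] a.
Proof.
rewrite /gerstenhaber sum2 !sum2 /=.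
by rewrite expr0 addn0 add0n expr1 expr2; ring.
Qed.

(** The four terms of the Gerstenhaber bracket contribute equally by the
    skew-symmetry of r, and the six terms of each determinant are equal in
    pairs. *)
Lemma yang_baxter al be ga :
  ext al (lie_br (sharp be) (sharp ga)) + ext be (lie_br (sharp ga) (sharp al))
  + ext ga (lie_br (sharp al) (sharp be)) = 0.
Proof.
have [_ /(_ (ext_scalar al) (ext_scalar be) (ext_scalar ga))] := hr.
have [W hW] : {W | forall x y z : g, W x y z =
    ext al x * (ext be y * ext ga z - ext ga y * ext be z)
    - ext be x * (ext al y * ext ga z - ext ga y * ext al z)
    + ext ga x * (ext al y * ext be z - ext be y * ext al z)} by eexists.
rewrite -/(cybe_sum _) (eq_cybe_sum _ (fun i j k l =>
  W (lie_br (e i) (e k)) (e j) (e l) - W (lie_br (e i) (e l)) (e j) (e k)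
  - W (lie_br (e j) (e k)) (e i) (e l) + W (lie_br (e j) (e l)) (e i) (e k)));
  last by move=> i j k l; rewrite gerstenhaber22E !wedge3E !hW.
rewrite !cybe_sumD !cybe_sumN.
rewrite (cybe_sum_swapr (fun i j k l => W (lie_br (e i) (e k)) (e j) (e l))).
rewrite (cybe_sum_swapl (fun i j k l => W (lie_br (e i) (e k)) (e j) (e l))).
rewrite (cybe_sum_swapl (fun i j k l => W (lie_br (e i) (e l)) (e j) (e k))).
rewrite (cybe_sum_swapr (fun i j k l => W (lie_br (e i) (e k)) (e j) (e l))).
set T := cybe_sum _ => H.
have {H} T0 : T = 0 by have : (4 : R) != 0 by []; lra.
have cyc a b c : cybe_sum (fun i j k l => ext a (lie_br (e i) (e k)) *
    (ext b (e j) * ext c (e l))) = ext a (lie_br (sharp b) (sharp c)).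
  by rewrite ext_br_sharp; apply: eq_cybe_sum => i j k l; rewrite !ext_basis.
have : T = 2 * (ext al (lie_br (sharp be) (sharp ga)) +
    ext be (lie_br (sharp ga) (sharp al)) + ext ga (lie_br (sharp al) (sharp be))).
  transitivity (
    ext al (lie_br (sharp be) (sharp ga)) - ext al (lie_br (sharp ga) (sharp be))
    - (ext be (lie_br (sharp al) (sharp ga)) - ext be (lie_br (sharp ga) (sharp al)))
    + (ext ga (lie_br (sharp al) (sharp be)) - ext ga (lie_br (sharp be) (sharp al)))).
    rewrite -!cyc -!cybe_sumN -!cybe_sumD -!cybe_sumN -!cybe_sumD.
    by apply: eq_cybe_sum => i j k l; rewrite hW; ring.
  rewrite (@lie_br_anti _ g (sharp ga) (sharp be)) (@lie_br_anti _ g (sharp al) (sharp ga)).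
  by rewrite (@lie_br_anti _ g (sharp be) (sharp al)) !extN; ring.
by rewrite T0; lra.
Qed.

End YangBaxter.

Arguments basis_expand {R g n E} hE x.
Arguments r_skew {R g n E r} hr i j.
Arguments ext_sharp_skew {R g n E r} hE hr al be.
Arguments yang_baxter {R g n E r} hE hr al be ga.

(** * The flat connection attached to an r-matrix *)

Section FlatAlgebra.
Context {R : realType}.
Variables (g : lie_algebra R) (n : nat) (E : n.-tuple g) (r : 'M[R]_n).
Hypothesis hE : basis_of fullv E.
Hypothesis hr : r_matrix (tnth E) r.

Let e := tnth E.
Notation sharp := (sharp g n E r).
Notation ext := (ext g n E).
Implicit Types be ga : 'I_n -> R.

Lemma ext_inj (x y : g) : (forall al, ext al x = ext al y) -> x = y.
Proof.
move=> H; rewrite (basis_expand hE x) (basis_expand hE y).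
apply: eq_bigr => k _; congr (_ *: _).
have F z : coord E k z = ext (fun l => (l == k)%:R) z.
  rewrite /ext (bigD1 k) //= eqxx mulr1 big1 ?addr0 // => l /negPf ->.
  by rewrite mulr0.
by rewrite !F H.
Qed.

(** The Lie bracket of functionals that r induces on g^*; it is the coboundary
    ad^*_(sharp be) ga - ad^*_(sharp ga) be, up to sign. *)
Definition coadjoint_bracket be ga (k : 'I_n) : R :=
  ext ga (lie_br (sharp be) (e k)) - ext be (lie_br (sharp ga) (e k)).

Lemma ext_coadjoint_bracket be ga x : ext (coadjoint_bracket be ga) x =
  ext ga (lie_br (sharp be) x) - ext be (lie_br (sharp ga) x).
Proof.
have F al z : ext al (lie_br z x) = \sum_k coord E k x * ext al (lie_br z (e k)).
  rewrite {1}(basis_expand hE x) lie_br_sumr ext_sum.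
  by apply: eq_bigr => k _; rewrite lie_brZr extZ.
rewrite !F -sumrB /ext; apply: eq_bigr => k _.
by rewrite -mulrBr.
Qed.

(** Up to the sign convention, r defines a homomorphism of Lie algebras from
    g^* to g: this is the form in which the Yang-Baxter equation is used. *)
Lemma sharp_coadjoint_bracket be ga :
  sharp (coadjoint_bracket be ga) = - lie_br (sharp be) (sharp ga).
Proof.
apply: ext_inj => al; rewrite (ext_sharp_skew hE hr) ext_coadjoint_bracket extN.
have := yang_baxter hE hr al be ga.
by rewrite (@lie_br_anti _ g (sharp al) (sharp be)) extN; lra.
Qed.

(** The matrix of the system dy = - [c, y], d eta = be(y) in a direction where
    the functional is be and c = sharp be.  The coordinate eta has index
    ord0, the coordinates of y have the indices lift ord0 k. *)
Definition conn be (i j : 'I_n.+1) : R :=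
  match unlift ord0 i, unlift ord0 j with
  | None, Some k => be k
  | Some l, Some k => - \sum_j contr n r be j * coord E l (lie_br (e j) (e k))
  | _, None => 0
  end.

Lemma conn_i0 be i : conn be i ord0 = 0.
Proof. by rewrite /conn unlift_none; case: unlift. Qed.

Lemma conn_0l be k : conn be ord0 (lift ord0 k) = be k.
Proof. by rewrite /conn unlift_none liftK. Qed.

Lemma conn_ll be l k :
  conn be (lift ord0 l) (lift ord0 k) = - coord E l (lie_br (sharp be) (e k)).
Proof.
rewrite /conn !liftK /sharp lie_br_suml; congr (- _); rewrite linear_sum.
by apply: eq_bigr => j _; rewrite lie_brZl linearZ.
Qed.

(** On the y-coordinates this combines the Jacobi identity with
    [sharp_coadjoint_bracket]; on the eta-coordinate it is the definition of
    the bracket of functionals. *)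
Lemma conn_flat be ga i j :
  \sum_m conn be i m * conn ga m j - \sum_m conn ga i m * conn be m j =
  conn (coadjoint_bracket be ga) i j.
Proof.
have [->|[k ->]] : j = ord0 \/ exists k, j = lift ord0 k.
- by case: (unliftP ord0 j) => [k ->|->]; [right; exists k | left].
- rewrite conn_i0 !big1 ?subrr // => m _; by rewrite conn_i0 mulr0.
rewrite !big_ord_recl !conn_i0 !mul0r !add0r.
have [->|[l ->]] : i = ord0 \/ exists k, i = lift ord0 k.
- by case: (unliftP ord0 i) => [l ->|->]; [right; exists l | left].
- rewrite conn_0l /coadjoint_bracket addrC -!sumrN; congr (_ + _).
    by apply: eq_bigr => m _; rewrite conn_0l conn_ll; ring.
  by apply: eq_bigr => m _; rewrite conn_0l conn_ll; ring.
have F al be' : \sum_m conn al (lift ord0 l) (lift ord0 m) *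
    conn be' (lift ord0 m) (lift ord0 k) =
    coord E l (lie_br (sharp al) (lie_br (sharp be') (e k))).
  rewrite [X in lie_br (sharp al) X](basis_expand hE) lie_br_sumr linear_sum.
  apply: eq_bigr => m _; rewrite !conn_ll lie_brZr linearZ /=; ring.
rewrite !F conn_ll sharp_coadjoint_bracket.
rewrite (@lie_br_anti _ g (- _)) lie_brN opprK.
rewrite (@lie_br_anti _ g (e k)) lie_br_ad !linearN /= linearB /=; ring.
Qed.

Lemma connB be ga i j :
  conn (fun k => be k - ga k) i j = conn be i j - conn ga i j.
Proof.
rewrite /conn; case: (unlift ord0 i) => [l|]; case: (unlift ord0 j) => [k|];
  rewrite ?subrr //.
rewrite -opprD -sumrB; congr (- _); apply: eq_bigr => m _.
rewrite -mulrBl; congr (_ * _).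
by rewrite /contr -sumrB; apply: eq_bigr => i' _; rewrite mulrBr.
Qed.

Lemma conn_eq0 be i j : (forall k, be k = 0) -> conn be i j = 0.
Proof.
move=> b0; rewrite /conn; case: (unlift ord0 i) => [l|]; case: (unlift ord0 j) => [k|] //.
rewrite big1 ?oppr0 // => m _; rewrite /contr big1 ?mul0r // => k' _.
by rewrite b0 mulr0.
Qed.

Lemma conn_ext be ga i j : (forall k, be k = ga k) -> conn be i j = conn ga i j.
Proof. by move=> /funext ->. Qed.

Lemma is_derive_conn (be : R -> 'I_n -> R) (be' : 'I_n -> R) (t : R) i j :
  (forall k, is_derive t 1 (fun x => be x k) (be' k)) ->
  is_derive t 1 (fun x => conn (be x) i j) (conn be' i j).
Proof.
move=> hb; rewrite /conn.
case: (unlift ord0 i) => [l|]; case: (unlift ord0 j) => [k|]; try exact: is_derive_cst.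
- apply: is_deriveN; apply: is_derive_lam_sum => m.
  have h := is_derive_lam_sum n _ t 1 _ (fun i' =>
    is_derive_lamM (is_derive_cst (r m i') t 1) (hb i')).
  have h2 := is_derive_lamM h (is_derive_cst (coord E l (lie_br (e m) (e k))) t 1).
  apply: (is_derive_eq h2); rewrite mulr0 addr0; congr (_ * _).
  by apply: eq_bigr => i' _; rewrite mul0r add0r.
- exact: hb.
Qed.

Lemma cont2_conn (be : R -> R -> 'I_n -> R) i j :
  (forall k, cont2 (fun x y => be x y k)) ->
  cont2 (fun x y => conn (be x y) i j).
Proof.
move=> hb; rewrite /conn.
case: (unlift ord0 i) => [l|]; case: (unlift ord0 j) => [k|]; try exact: cont2_cst.
- apply: cont2N; apply: cont2_sum => m; apply: cont2M; last exact: cont2_cst.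
  by apply: cont2_sum => i'; apply: cont2M => //; exact: cont2_cst.
- exact: hb.
Qed.

End FlatAlgebra.

Arguments conn_flat {R g n E r} hE hr be ga i j.

(** * The sphere with an inducing action *)

Section InducedPoisson.
Context {R : realType}.
Notation V := 'rV[R]_3.
Variable w : V -> V -> V -> R.
Hypothesis hw : symplectic_form w.
Variables (g : lie_algebra R) (phi : g -> V -> V) (n : nat) (E : n.-tuple g).
Variable r : 'M[R]_n.
Hypothesis hE : basis_of fullv E.
Hypothesis hphi : lie_action phi.
Hypothesis hr : r_matrix (tnth E) r.
Hypothesis hpi : poisson_bivector_of w (induced_bivector phi (tnth E) r).
Implicit Types (p u v : V).

Let f k p := phi (tnth E k) p.

(** The functional x |-> w(u, phi(x)) at p, by its values on the basis; the
    determinant formula makes sense, and is differentiable, without assuming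
    that u is tangent. *)
Definition pairing p u (k : 'I_n) : R := density w p * det3 p u (phi (tnth E k) p).

Let tf : two_form w. Proof. by case: hw. Qed.

Lemma tangent_phi x p : sphere p -> tangent p (phi x p).
Proof. by move=> sp; have [/(_ x) [H _] _ _] := hphi; exact: H. Qed.

Lemma phiP a x y p : sphere p -> phi (a *: x + y) p = a *: phi x p + phi y p.
Proof. by move=> sp; have [_ H _] := hphi; exact: H. Qed.

Lemma phi0 p : sphere p -> phi 0 p = 0.
Proof.
by move=> sp; have := phiP (-1) 0 0 p sp; rewrite scaler0 addr0 scaleN1r addNr.
Qed.

Lemma phi_comb m (c : 'I_m -> R) (x : 'I_m -> g) p : sphere p ->
  phi (\sum_i c i *: x i) p = \sum_i c i *: phi (x i) p.
Proof.
move=> sp; elim: m c x => [|m IHm] c x; first by rewrite !big_ord0 phi0.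
by rewrite !big_ord_recl phiP // IHm.
Qed.

Lemma phi_expand x p : sphere p -> phi x p = \sum_k coord E k x *: f k p.
Proof. by move=> sp; rewrite {1}(basis_expand hE x) phi_comb. Qed.

Lemma form_phi p u k : sphere p -> tangent p u -> w p u (f k p) = pairing p u k.
Proof. by move=> sp tu; rewrite two_form_area //; exact: tangent_phi. Qed.

Lemma ext_pairing p u x : sphere p ->
  ext g n E (pairing p u) x = density w p * det3 p u (phi x p).
Proof.
move=> sp; rewrite (phi_expand x p sp) det3_comb mulr_sumr.
by apply: eq_bigr => k _; rewrite /pairing mulrCA.
Qed.

(** That the induced bivector is inverse to w, in coordinates. *)
Lemma pairing_form p u v : sphere p -> tangent p u -> tangent p v ->
  \sum_i \sum_j r i j * (pairing p u i * pairing p v j) = w p u v.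
Proof.
move=> sp tu tv; rewrite -(hpi p u v sp tu tv) /induced_bivector /bivector.
have -> : \sum_(i < n) \sum_(j < n) r i j *
    wedge [:: phi (tnth E i) p; phi (tnth E j) p] [:: w p u; w p v] =
  \sum_i \sum_j r i j * (pairing p u i * pairing p v j) +
  \sum_i \sum_j r i j * (pairing p u i * pairing p v j).
  rewrite [X in _ = _ + X]exchange_big -big_split; apply: eq_bigr => i _ /=.
  rewrite -big_split; apply: eq_bigr => j _ /=.
  by rewrite wedge2E !form_phi // (r_skew hr j i); ring.
by field.
Qed.

(** Both sides have the same w-product with every tangent vector, by
    [pairing_form] and the skew-symmetry of r. *)
Lemma contr_pairing p u : sphere p -> tangent p u ->
  \sum_j contr n r (pairing p u) j *: f j p = u.
Proof.
move=> sp tu; apply/eqP; rewrite -subr_eq0; apply/eqP.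
have tc : tangent p (\sum_j contr n r (pairing p u) j *: f j p).
  rewrite -phi_comb //; exact: tangent_phi.
have [_ _ nondeg] := hw.
have td : tangent p (\sum_j contr n r (pairing p u) j *: f j p - u).
  by rewrite addrC -scaleN1r; exact: tangentD.
apply: (nondeg p) => // v tv.
rewrite addrC -scaleN1r two_form_linl // mulN1r -(pairing_form p u v) //.
rewrite two_form_area // -phi_comb // det3_swap mulrN.
rewrite (_ : det3 p v _ = \sum_j contr n r (pairing p u) j * det3 p v (f j p)); last first.
  by rewrite phi_comb // det3_comb.
rewrite mulr_sumr exchange_big -!sumrN -big_split big1 //= => j _.
rewrite /contr mulr_suml mulr_sumr -!sumrN -big_split big1 //= => i _.
by rewrite (r_skew hr i j) /pairing /f; ring.
Qed.

Lemma density_neq0 p : sphere p -> density w p != 0.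
Proof.
move=> sp; apply/eqP => d0.
have [_ _ nondeg] := hw.
have z k : rot k p = 0.
  apply: (nondeg p) => //; first exact: tangent_rot.
  by move=> v tv; rewrite two_form_area ?d0 ?mul0r //; exact: tangent_rot.
have := sphere_neq0 sp; apply/negP; rewrite negbK; apply/eqP/rowP.
apply: ord3P; rewrite mxE.
- have h : rot i2 p 0 i1 = p 0 i0 by rewrite rotE.
  by rewrite -h z mxE.
- have h : rot i0 p 0 i2 = p 0 i1 by rewrite rotE.
  by rewrite -h z mxE.
- have h : rot i1 p 0 i0 = p 0 i2 by rewrite rotE.
  by rewrite -h z mxE.
Qed.

(** The complete contraction of w with its inverse, that is the dimension of
    the sphere.  Skew-symmetrizing [pairing_form] in u and v and applying
    [det3_pluecker] gives it as the factor of w(u, v). *)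
Lemma trace_pairing p : sphere p ->
  \sum_i \sum_j r i j * (density w p * det3 p (f i p) (f j p)) = 2.
Proof.
move=> sp; have d0 := density_neq0 p sp.
set T := \sum_i _.
have H u v : tangent p u -> tangent p v -> det3 p u v * T = 2 * det3 p u v.
  move=> tu tv; apply: (mulfI d0).
  have wE := two_form_area w tf p u v sp tu tv.
  transitivity (2 * w p u v); last by rewrite wE; ring.
  have -> : 2 * w p u v =
    \sum_i \sum_j r i j * (pairing p u i * pairing p v j) +
    \sum_i \sum_j r i j * (pairing p u i * pairing p v j).
    by rewrite pairing_form //; ring.
  rewrite [X in _ = _ + X]exchange_big -big_split mulrA mulr_sumr.
  apply: eq_bigr => i _; rewrite -big_split mulr_sumr; apply: eq_bigr => j _ /=.
  rewrite (r_skew hr j i) /pairing -/(f i p) -/(f j p).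
  have P := det3_pluecker p u v (f i p) (f j p).
  transitivity (r i j * density w p * density w p * (det3 p u v * det3 p (f i p) (f j p))).
    by ring.
  by rewrite -P; ring.
have t := tangent_rot _ p sp.
have [k [l kl]] : exists k l, det3 p (rot k p) (rot l p) != 0.
  apply: contrapT => H0.
  have z k l : det3 p (rot k p) (rot l p) = 0.
    by apply/eqP/negPn/negP => h; apply: H0; exists k, l.
  have := sphere_neq0 sp; apply/negP; rewrite negbK; apply/eqP/rowP.
  have pp : dot p p = 1 by [].
  apply: ord3P; rewrite mxE -[LHS]mulr1 -pp.
  - by rewrite -(z i1 i2) /det3 !rotE dotE; ring.
  - by rewrite -(z i2 i0) /det3 !rotE dotE; ring.
  - by rewrite -(z i0 i1) /det3 !rotE dotE; ring.
have := H _ _ (t k) (t l); rewrite mulrC => /(mulIf kl).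
exact.
Qed.

Lemma Ck1_phi k : Ck 1 (@punctured R) (fun x => f k (radial x)).
Proof.
by apply: (smooth_Ck1 (f k)); have [/(_ (tnth E k)) [_ H] _ _] := hphi.
Qed.

Let F k (x : V) := f k (radial x).

Let dF k p : sphere p -> differentiable (F k) p.
Proof. by move=> /sphere_neq0; have [H _] := Ck1P.1 (Ck1_phi k); exact: H. Qed.

Let drho p : sphere p -> differentiable (fun x => density w (radial x)) p.
Proof.
by move=> /sphere_neq0; have [H _] := Ck1P.1 (Ck1_density w tf); exact: H.
Qed.

Let dFi k p u i : sphere p ->
  is_derive p u (fun y => F k y 0 i) (('D_u (F k) p) 0 i).
Proof. by move=> sp; apply: derive_coord; exact: dF. Qed.

(** The derivative of the constant of [trace_pairing], solved for the
    derivative of the density. *)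
Lemma derive_trace p z : sphere p -> tangent p z ->
  'D_z (fun x => density w (radial x)) p =
    - (density w p ^+ 2 *
       \sum_i \sum_j r i j * det3 p (f i p) ('D_z (F j) p)).
Proof.
move=> sp tz; set S := \sum_i _; have d0 := density_neq0 p sp.
have rp := radial_id sp.
have FE k : F k p = f k p by rewrite /F rp.
set dr := 'D_z _ p.
have hr1 : is_derive p z (fun x => density w (radial x)) dr.
  by apply/derivableP; apply: diff_derivable; exact: drho.
have hR i : is_derive p z (fun x : V => radial x 0 i) (z 0 i).
  have -> : z 0 i = ('D_z (@radial R) p) 0 i by rewrite derive_radial.
  apply: derive_coord.
  by have [H _] := Ck1P.1 (@Ck1_radial R); exact: H (sphere_neq0 sp).
have h i j := is_derive_lamM (is_derive_cst (r i j) p z)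
  (is_derive_lamM hr1
    (is_derive_det3 (@radial R) (F i) (F j) p z _ _ _ hR
       (fun l => dFi i p z l sp) (fun l => dFi j p z l sp))).
have hs := is_derive_lam_sum n _ p z _ (fun i => is_derive_lam_sum n _ p z _ (h i)).
have h0 : is_derive p z (fun x : V => \sum_i \sum_j
    cst (r i j) x * (density w (radial x) * det3 (radial x) (F i x) (F j x))) 0.
  have hc : is_derive p z (fun _ : V => 2 : R) 0 by exact: is_derive_cst.
  apply: near_eq_is_derive hc.
  apply: (open_near (@punctured R)); first exact: open_punctured.
    exact: sphere_neq0.
  by move=> y y0; rewrite -(trace_pairing (radial y)) //; exact: sphere_radial.
have : _ = 0 := etrans (esym (@derive_val _ _ _ _ _ _ _ hs)) (@derive_val _ _ _ _ _ _ _ h0).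
set Sf := \sum_i _.
have -> : Sf = dr * \sum_i \sum_j r i j * det3 p (f i p) (f j p) + 2 * density w p * S.
  transitivity (dr * \sum_i \sum_j r i j * det3 p (f i p) (f j p) +
    (density w p * S + density w p * \sum_i \sum_j r i j * det3 p ('D_z (F i) p) (f j p))).
    rewrite /Sf /S !mulr_sumr -!big_split; apply: eq_bigr => i _.
    rewrite !mulr_sumr -!big_split; apply: eq_bigr => j _ /=.
    rewrite !FE rp (det3_tangent p z) //; try exact: tangent_phi.
    by rewrite /cst; ring.
  have -> : \sum_i \sum_j r i j * det3 p ('D_z (F i) p) (f j p) = S.
    rewrite /S exchange_big; apply: eq_bigr => j _; apply: eq_bigr => i _ /=.
    by rewrite (r_skew hr i j) det3_swap; ring.
  by ring.
have T := trace_pairing p sp.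
have {}T : density w p * \sum_i \sum_j r i j * det3 p (f i p) (f j p) = 2.
  rewrite -T mulr_sumr; apply: eq_bigr => i _; rewrite mulr_sumr.
  by apply: eq_bigr => j _; ring.
move: T; move: (\sum_i _) => T hT e0.
have := congr1 (fun x => density w p * x) e0; rewrite mulr0 mulrDr mulrCA hT.
move: (density w p) => d H; nra.
Qed.

(** The bracket of the field of sharp(b_u), whose value at p is u, with a basis
    field; u is frozen, so only the first field is differentiated through its
    coordinates on the basis. *)
Lemma phi_br_sharp p u k : sphere p -> tangent p u ->
  phi (lie_br (sharp g n E r (pairing p u)) (tnth E k)) p =
  'D_u (F k) p - \sum_j contr n r (pairing p u) j *: 'D_(f k p) (F j) p.
Proof.
move=> sp tu; have [_ _ ->] := hphi; last by [].
rewrite /field_bracket /sphere_derive phi_comb // contr_pairing //.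
congr (_ - _).
pose G x := \sum_j contr n r (pairing p u) j *: F j x.
transitivity ('D_(f k p) G p).
  apply: near_eq_derive; apply: (open_near (@punctured R)).
  - exact: open_punctured.
  - exact: sphere_neq0.
  - by move=> y y0; rewrite /G phi_comb //; exact: sphere_radial.
have h j : is_derive p (f k p) (fun x => contr n r (pairing p u) j *: F j x)
    (contr n r (pairing p u) j *: 'D_(f k p) (F j) p).
  apply: is_deriveZ; apply/derivableP; apply: diff_derivable; exact: dF.
have := derive_sum (fun j => @ex_derive _ _ _ _ _ _ _ (h j)).
rewrite /G (_ : (fun x => _) = \sum_j (fun x => contr n r (pairing p u) j *: F j x)).
  by move=> ->; apply: eq_bigr => j _; exact: (derive_val (is_derive := h j)).
by apply/funext => x; rewrite fct_sumE.
Qed.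

(** The exterior derivative of u |-> b_u.  The terms in which the basis field is
    differentiated along u and v match those of [phi_br_sharp].  The other ones
    reduce, by [derive_cyclic] and [det3_pluecker], to multiples of
    det(p, u, v), and their coefficients agree by [derive_trace]. *)
Lemma pairing_structure_eq p u v k : sphere p -> tangent p u -> tangent p v ->
  ('D_u (fun x => density w (radial x)) p * det3 p v (f k p)
     + density w p * det3 p v ('D_u (F k) p))
  - ('D_v (fun x => density w (radial x)) p * det3 p u (f k p)
     + density w p * det3 p u ('D_v (F k) p)) =
  coadjoint_bracket g n E r (pairing p u) (pairing p v) k.
Proof.
move=> sp tu tv.
have rp := radial_id sp.
have FE l : F l p = f l p by rewrite /F rp.
have tz : tangent p (f k p) by exact: tangent_phi.
pose psi j := 'D_(f k p) (F j) p.
rewrite /coadjoint_bracket !ext_pairing // !phi_br_sharp //.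
have det3B (q x y c : V) : det3 q x (y - c) = det3 q x y - det3 q x c.
  by rewrite /det3 !mxE; ring.
rewrite !det3B !det3_comb.
have cyc := derive_cyclic _ p u v (f k p) (drho p sp) sp tu tv tz.
rewrite (derive_trace p _ sp tz) in cyc.
have Q : \sum_j contr n r (pairing p u) j * det3 p v (psi j) -
    \sum_j contr n r (pairing p v) j * det3 p u (psi j) =
    - (density w p * det3 p u v * \sum_i \sum_j r i j * det3 p (f i p) (psi j)).
  rewrite exchange_big -sumrB mulr_sumr -sumrN; apply: eq_bigr => j _.
  rewrite /contr !mulr_suml -sumrB mulr_sumr -sumrN; apply: eq_bigr => i _ /=.
  rewrite /pairing -/(f i p) (r_skew hr j i).
  have P := det3_pluecker p u v (f i p) (psi j).
  transitivity (- (r i j * density w p * (det3 p u v * det3 p (f i p) (psi j)))).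
    by rewrite -P; ring.
  by ring.
have fin (a b d x y c1 c2 D S : R) : a - b = - (- (d ^+ 2 * S) * D) ->
    c1 - c2 = - (d * D * S) ->
    (a + d * x) - (b + d * y) = d * (x - c1) - d * (y - c2).
  move=> e1 e2; transitivity ((a - b) + d * (x - y)); first by ring.
  transitivity (d * (x - y) - d * (c1 - c2)); last by ring.
  by rewrite e1 e2; ring.
exact: fin cyc Q.
Qed.

Implicit Types (x y t : R).

(** The pull-back of b to the coordinate plane: its values on the two partial
    derivatives of Psi. *)
Let bp x y := pairing (Psi x y) (Psix x y).
Let bq x y := pairing (Psi x y) (Psiy x y).

Let Drho p u := 'D_u (fun q : V => density w (radial q)) p.

(** The derivative of the pairing when p moves with velocity p' and u with
    velocity u'. *)
Definition dpairing (p u p' u' : V) (k : 'I_n) : R := Drho p p' * det3 p u (f k p)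
  + density w p * (det3 p' u (f k p) + det3 p u' (f k p) + det3 p u ('D_p' (F k) p)).

Let sP (x y : R) : sphere (Psi x y) := sphere_Psi x y.

Lemma is_derive_phi (c : R -> V) (c' : V) (t : R) k i :
  (forall t, sphere (c t)) ->
  (forall i, is_derive t 1 (fun t => c t 0 i) (c' 0 i)) ->
  is_derive t 1 (fun t => f k (c t) 0 i) (('D_c' (F k) (c t)) 0 i).
Proof.
move=> sc dc; have dFc := dF k _ (sc t).
have [_ <-] := derive_coord _ (F k) (c t) c' i dFc.
have -> : (fun t => f k (c t) 0 i) = (fun t => F k (c t) 0 i).
  by apply/funext => z; rewrite /F radial_id.
apply: (chain_rule 3 c c' t (fun q : V => F k q 0 i) dc).
exact: differentiable_component.
Qed.

Lemma is_derive_pairing (c a : R -> V) (c' a' : V) (t : R) k :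
  (forall t, sphere (c t)) ->
  (forall i, is_derive t 1 (fun t => c t 0 i) (c' 0 i)) ->
  (forall i, is_derive t 1 (fun t => a t 0 i) (a' 0 i)) ->
  is_derive t 1 (fun t => pairing (c t) (a t) k) (dpairing (c t) (a t) c' a' k).
Proof.
move=> sc dc da.
have h1 := chain_rule 3 c c' t (fun q : V => density w (radial q)) dc (drho _ (sc t)).
have hF i := is_derive_phi c c' t k i sc dc.
have h := is_derive_lamM h1 (is_derive_det3 c a (fun t => f k (c t)) t 1 _ _ _ dc da hF).
have -> : (fun t => pairing (c t) (a t) k) =
    (fun t => density w (radial (c t)) * det3 (c t) (a t) (f k (c t))).
  by apply/funext => z; rewrite /pairing radial_id.
by apply: (is_derive_eq h); rewrite /dpairing !radial_id.
Qed.

Let bqx x y := dpairing (Psi x y) (Psiy x y) (Psix x y) (Psixy x y).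
Let bpy x y := dpairing (Psi x y) (Psix x y) (Psiy x y) (Psixy x y).

Lemma is_derive_bq (x y : R) k : is_derive x 1 (fun x => bq x y k) (bqx x y k).
Proof.
apply: (is_derive_pairing (fun x => Psi x y) (fun x => Psiy x y)) => // i.
  exact: is_derive_Psi_x.
exact: is_derive_Psiy_x.
Qed.

Lemma is_derive_bp (x y : R) k : is_derive y 1 (fun y => bp x y k) (bpy x y k).
Proof.
apply: (is_derive_pairing (fun y => Psi x y) (fun y => Psix x y)) => // i.
  exact: is_derive_Psi_y.
exact: is_derive_Psix_y.
Qed.

(** The mixed partial derivatives of Psi cancel, so [pairing_structure_eq]
    pulls back. *)
Lemma curvature x y k :
  bqx x y k - bpy x y k = coadjoint_bracket g n E r (bp x y) (bq x y) k.
Proof.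
have tx := tangent_Psix x y; have ty := tangent_Psiy x y.
rewrite /bp /bq -pairing_structure_eq // /bqx /bpy /dpairing.
have tk : tangent (Psi x y) (f k (Psi x y)) by exact: tangent_phi.
rewrite (det3_tangent (Psi x y) (Psix x y)) // (det3_tangent (Psi x y) (Psiy x y)) //.
have cancel (a b d X Y Y' : R) :
  (a + d * (0 + X + Y)) - (b + d * (0 + X + Y')) = (a + d * Y) - (b + d * Y') by ring.
exact: cancel.
Qed.

Lemma cont2_rho : cont2 (fun x y => density w (Psi x y)).
Proof.
have -> : (fun x y => density w (Psi x y)) = (fun x y => (fun q : V => density w (radial q)) (Psi x y)).
  by apply/funext => x; apply/funext => y; rewrite radial_id.
apply: (cont2_comp_Psi (fun q => density w (radial q))) => p sp.
by apply: differentiable_continuous; exact: drho.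
Qed.

Lemma cont2V_phi k : cont2V 3 (fun x y => f k (Psi x y)).
Proof.
move=> i.
have -> : (fun x y => f k (Psi x y) 0 i) = (fun x y => (fun q : V => F k q 0 i) (Psi x y)).
  by apply/funext => x; apply/funext => y; rewrite /F radial_id.
apply: (cont2_comp_Psi (fun q => F k q 0 i)) => p sp.
apply: differentiable_continuous.
by apply: differentiable_component; exact: dF.
Qed.

Lemma cont2_derive (G : V -> R) (A : R -> R -> V) : Ck 1 (@punctured R) G ->
  cont2V 3 A -> cont2 (fun x y => 'D_(A x y) G (Psi x y)).
Proof.
move=> /Ck1P[dG cG] cA.
have -> : (fun x y => 'D_(A x y) G (Psi x y)) =
    (fun x y => \sum_i A x y 0 i * (fun q => 'D_(delta_mx 0 i) G q) (Psi x y)).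
  apply/funext => x; apply/funext => y; rewrite derive_sum_basis //.
  by apply: dG; exact: sphere_neq0.
apply: cont2_sum => i; apply: cont2M; first exact: cA.
apply: (cont2_comp_Psi (fun q => 'D_(delta_mx 0 i) G q)) => p sp; apply: cG; exact: sphere_neq0.
Qed.

Lemma cont2V_dphi k (A : R -> R -> V) : cont2V 3 A ->
  cont2V 3 (fun x y => 'D_(A x y) (F k) (Psi x y)).
Proof.
move=> cA i.
have -> : (fun x y => ('D_(A x y) (F k) (Psi x y)) 0 i) =
    (fun x y => 'D_(A x y) (fun q => F k q 0 i) (Psi x y)).
  apply/funext => x; apply/funext => y.
  by have [_ ->] := derive_coord _ (F k) (Psi x y) (A x y) i (dF k _ (sP x y)).
apply: cont2_derive => //; apply: Ck1_component; first exact: open_punctured.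
exact: Ck1_phi.
Qed.

Lemma cont2_pairing A k : cont2V 3 A -> cont2 (fun x y => pairing (Psi x y) (A x y) k).
Proof.
move=> cA; apply: cont2M; first exact: cont2_rho.
by apply: cont2_det3 => //; [exact: cont2V_Psi | exact: cont2V_phi].
Qed.

Lemma cont2_bqx k : cont2 (fun x y => bqx x y k).
Proof.
have c0 := @cont2V_Psi R; have cx := @cont2V_Psix R; have cy := @cont2V_Psiy R.
have cxy := @cont2V_Psixy R; have cf := cont2V_phi k.
apply: cont2D.
  apply: cont2M; last exact: cont2_det3.
  by apply: cont2_derive => //; exact: Ck1_density.
apply: cont2M; first exact: cont2_rho.
by apply: cont2D; [apply: cont2D |]; apply: cont2_det3 => //; exact: cont2V_dphi.
Qed.


Lemma derive_comb {W : normedModType R} (G : V -> W) p m (c : 'I_m -> R) (v : 'I_m -> V) :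
  differentiable G p -> 'D_(\sum_i c i *: v i) G p = \sum_i c i *: 'D_(v i) G p.
Proof.
move=> dG; elim: m c v => [|m IHm] c v; first by rewrite !big_ord0 derive0.
by rewrite !big_ord_recl derive_linear // IHm.
Qed.

(** The derivative of the field Z = phi(y), for dy = - [c, y], along a curve of
    velocity u is a linear expression in Z: the brackets produce
    - dZ(u) through phi(c(u)) = u, leaving only the derivatives of the basis
    fields in the direction Z itself. *)
Lemma parallel_field_eq p u (sg : 'I_n -> R) : sphere p -> tangent p u ->
  \sum_k (- \sum_m coord E k (lie_br (sharp g n E r (pairing p u)) (tnth E m)) * sg m) *: f k p
    + \sum_k sg k *: 'D_u (F k) p =
  \sum_j contr n r (pairing p u) j *: 'D_(\sum_k sg k *: f k p) (F j) p.
Proof.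
move=> sp tu.
have -> : \sum_k (- \sum_m coord E k (lie_br (sharp g n E r (pairing p u)) (tnth E m)) * sg m) *: f k p =
    \sum_m (- sg m) *: phi (lie_br (sharp g n E r (pairing p u)) (tnth E m)) p.
  under [RHS]eq_bigr do rewrite phi_expand // scaler_sumr.
  rewrite exchange_big; apply: eq_bigr => k _ /=.
  rewrite -sumrN scaler_suml; apply: eq_bigr => m _.
  by rewrite scalerA; congr (_ *: _); ring.
under [X in X + _ = _]eq_bigr do rewrite phi_br_sharp //.
rewrite -big_split /=.
under [RHS]eq_bigr do rewrite (derive_comb _ _ _ _ _ (dF _ _ sp)) scaler_sumr.
rewrite exchange_big; apply: eq_bigr => m _ /=.
rewrite scalerBr scaleNr scaleNr opprK addrAC addNr add0r scaler_sumr.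
by apply: eq_bigr => j _; rewrite !scalerA mulrC.
Qed.

Let Q x y := conn g n E r (bq x y).
Let P x y := conn g n E r (bp x y).

(** The parallels degenerate to a point at the poles. *)
Lemma conn_pole x y i j : sin y = 0 -> P x y i j = 0.
Proof.
move=> sy; apply: conn_eq0 => k.
by rewrite /bp /pairing /det3 !vecE sy; ring.
Qed.

Lemma parallel_sections (s0 : 'I_n.+1 -> R) (a b : R) : a < b -> sin a = 0 ->
  exists s : R -> R -> 'I_n.+1 -> R,
  [/\ forall x i, s x a i = s0 i,
      forall x i, {within `[a, b], continuous (fun y => s x y i)},
      forall (x y : R) i, y \in `]a, b[ ->
        is_derive y 1 (fun y => s x y i) (\sum_j Q x y i j * s x y j),
      forall (x y : R) i, y \in `]a, b[ ->
        is_derive x 1 (fun x => s x y i) (\sum_j P x y i j * s x y j)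
    & forall i z, z.2 \in `]a, b[ ->
        {for z, continuous (fun z : R * R => s z.1 z.2 i)}].
Proof.
move=> ab sa0.
have cQ i j : cont2 (fun x y => Q x y i j).
  by apply: cont2_conn => k; apply: cont2_pairing; exact: cont2V_Psiy.
have cP i j : cont2 (fun x y => P x y i j).
  by apply: cont2_conn => k; apply: cont2_pairing; exact: cont2V_Psix.
have cQx i j : cont2 (fun x y => conn g n E r (bqx x y) i j).
  by apply: cont2_conn => k; exact: cont2_bqx.
have dP (x y : R) i j : is_derive y 1 (fun y => P x y i j) (conn g n E r (bpy x y) i j).
  by apply: is_derive_conn => k; exact: is_derive_bp.
have dQ (x y : R) i j : is_derive x 1 (fun x => Q x y i j) (conn g n E r (bqx x y) i j).
  by apply: is_derive_conn => k; exact: is_derive_bq.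
have flat x y i j : conn g n E r (bpy x y) i j + \sum_k P x y i k * Q x y k j =
    conn g n E r (bqx x y) i j + \sum_k Q x y i k * P x y k j.
  have H := conn_flat hE hr (bp x y) (bq x y) i j.
  rewrite -(conn_ext _ _ _ _ _ _ i j (curvature x y)) connB in H.
  have rearrange (A B C D : R) : A - B = C - D -> D + A = C + B.
    by move=> e; rewrite -(subrK D C) -e; ring.
  exact: rearrange H.
have Pa x i j : P x a i j = 0 by exact: conn_pole.
have h x := linear_ode n.+1 (Q x) s0 a b ab
  (fun i j => continuous_subspaceT (continuous_slice2 (fun x y => Q x y i j) x (cQ i j))).
pose s x := sval (cid (h x)).
have hs x := svalP (cid (h x)).
have sa x i : s x a i = s0 i by have [H _ _] := hs x; exact: H.
have cs x i : {within `[a, b], continuous (fun y => s x y i)}.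
  by have [_ H _] := hs x; exact: H.
have ds x y i : y \in `]a, b[ ->
    is_derive y 1 (fun y => s x y i) (\sum_j Q x y i j * s x y j).
  by have [_ _ H] := hs x; exact: H.
exists s; split.
- exact: sa.
- exact: cs.
- exact: ds.
- exact: (flat_transport _ _ _ _ _ _ _ _ ab cP cQ cQx dP dQ flat Pa s sa cs ds).
- exact: (flat_continuous _ _ _ _ _ ab cQ s sa cs ds).
Qed.


Lemma comb_coord m (c : 'I_m -> R) (v : 'I_m -> V) (i : 'I_3) :
  (\sum_k c k *: v k) 0 i = \sum_k c k * v k 0 i.
Proof. by rewrite summxE; apply: eq_bigr => k _; rewrite mxE. Qed.

Lemma comb_eq_coord m (c d h : 'I_m -> R) (u v z : 'I_m -> V) (i : 'I_3) :
  \sum_k c k *: u k + \sum_k d k *: v k = \sum_k h k *: z k ->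
  \sum_k c k * u k 0 i + \sum_k d k * v k 0 i = \sum_k h k * z k 0 i.
Proof. by move=> H; rewrite -!comb_coord -H mxE. Qed.

(** By [parallel_field_eq] the field satisfies a homogeneous linear equation
    along the meridian, so [energy_lower] applies. *)
Lemma parallel_field_eq0 x (sg : R -> 'I_n.+1 -> R) (a b : R) :
  (forall i, {within `[a, b], continuous (fun y => sg y i)}) ->
  (forall y i, y \in `]a, b[ ->
     is_derive y 1 (fun y => sg y i) (\sum_j Q x y i j * sg y j)) ->
  forall y, y \in `[a, b] ->
    \sum_k sg y (lift ord0 k) *: f k (Psi x y) = 0 ->
    \sum_k sg a (lift ord0 k) *: f k (Psi x a) = 0.
Proof.
move=> cs ds y yab Zy.
pose Z y : V := \sum_k sg y (lift ord0 k) *: f k (Psi x y).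
pose L y (i m : 'I_3) : R :=
  \sum_j contr n r (bq x y) j * ('D_(delta_mx 0 m) (F j) (Psi x y)) 0 i.
have ZE y' i : Z y' 0 i = \sum_k sg y' (lift ord0 k) * f k (Psi x y') 0 i.
  exact: comb_coord.
have cL i m : {within `[a, b], continuous (fun y => L y i m)}.
  have c2 : cont2 (fun x y =>
      \sum_j contr n r (bq x y) j * ('D_(delta_mx 0 m) (F j) (Psi x y)) 0 i).
    apply: cont2_sum => j; apply: cont2M.
      apply: cont2_sum => k; apply: cont2M; first exact: cont2_cst.
      by apply: cont2_pairing; exact: cont2V_Psiy.
    by apply: (cont2V_dphi j (fun _ _ => delta_mx 0 m)) => l; exact: cont2_cst.
  exact: (continuous_subspaceT (continuous_slice2 _ x c2)).
have [M M0 LM] := bounded_entries cL.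
have cZ i : {within `[a, b], continuous (fun y => Z y 0 i)}.
  have -> : (fun y => Z y 0 i) = (fun y => \sum_k sg y (lift ord0 k) * f k (Psi x y) 0 i).
    by apply/funext => y'; exact: ZE.
  apply: within_continuous_lam_sum => k; apply: within_continuous_lamM => //.
  exact: (continuous_subspaceT (continuous_slice2 _ x (cont2V_phi k i))).
have dZ y' i : y' \in `]a, b[ ->
    is_derive y' 1 (fun y => Z y 0 i) (\sum_m L y' i m * Z y' 0 m).
  move=> y'ab.
  have h := is_derive_lam_sum n _ y' 1 _ (fun k =>
    is_derive_lamM (ds y' (lift ord0 k) y'ab)
      (is_derive_phi (fun y => Psi x y) (Psiy x y') y' k i (fun y => sP x y)
         (is_derive_Psi_y x y'))).
  have -> : (fun y => Z y 0 i) = (fun y => \sum_k sg y (lift ord0 k) * f k (Psi x y) 0 i).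
    by apply/funext => z; exact: ZE.
  apply: (is_derive_eq h).
  have tu := tangent_Psiy x y'.
  have H := comb_eq_coord _ _ _ _ _ _ _ i
    (parallel_field_eq _ _ (fun k => sg y' (lift ord0 k)) (sP x y') tu).
  transitivity (\sum_j contr n r (bq x y') j * ('D_(Z y') (F j) (Psi x y')) 0 i).
    rewrite big_split; apply: etrans H; congr (_ + _); apply: eq_bigr => k _ /=.
    rewrite big_ord_recl /Q conn_i0 mul0r add0r; congr (_ * _).
    rewrite -sumrN; apply: eq_bigr => m _.
    by rewrite conn_ll mulNr.
  rewrite /L; under [RHS]eq_bigr do rewrite mulr_suml.
  rewrite exchange_big; apply: eq_bigr => j _ /=.
  rewrite derive_sum_basis; last exact: dF.
  rewrite comb_coord mulr_sumr; apply: eq_bigr => m _; ring.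
have h : \sum_i Z a 0 i ^+ 2 <=
    (\sum_i Z y 0 i ^+ 2) * expR (2 * 3%:R * M * (y - a)).
  rewrite mulr_suml; exact: (energy_lower 3 L a b M (fun y i => Z y 0 i) M0
  (fun t i j th => LM t i j (subset_itv_oo_cc th)) cZ dZ y yab).
have z0 : \sum_i Z y 0 i ^+ 2 = 0.
  by rewrite (_ : Z y = 0) // big1 // => i _; rewrite mxE expr0n.
rewrite z0 mul0r in h; apply/rowP => i; rewrite mxE.
exact: (sum_sqr_eq0 _ (fun i => Z a 0 i) h).
Qed.

Lemma tangent_comb p (c : 'I_n -> R) : sphere p -> tangent p (\sum_k c k *: f k p).
Proof. by move=> sp; rewrite -phi_comb //; exact: tangent_phi. Qed.

Lemma conn_row0 (be : 'I_n -> R) (sg : 'I_n.+1 -> R) :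
  \sum_j conn g n E r be ord0 j * sg j = \sum_k be k * sg (lift ord0 k).
Proof.
rewrite big_ord_recl conn_i0 mul0r add0r; apply: eq_bigr => k _.
by rewrite conn_0l.
Qed.

Lemma pairing_comb p u (c : 'I_n -> R) :
  \sum_k pairing p u k * c k = density w p * det3 p u (\sum_k c k *: f k p).
Proof.
by rewrite det3_comb mulr_sumr; apply: eq_bigr => k _; rewrite /pairing; ring.
Qed.

(** The maximum of eta over the strip 0 <= y <= pi exists because eta is
    periodic in x.  If it is not attained at a pole, it is a critical point. At
    a pole the one-sided derivative along the meridian of longitude x has a
    fixed sign; since it changes sign with x |-> x + pi, it vanishes for
    all x. *)
Lemma symplectic_not_induced : False.
Proof.
have pi0 := pi_gt0 R.
(* The meridians start at the pole y = - pi, outside the strip where eta is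
   maximized, so that both poles of the strip are interior to [a, b]. *)
pose a : R := - pi; pose b : R := pi *+ 2.
have bE : b = pi + pi by rewrite /b mulr2n.
have ab : a < b by rewrite bE /a; lra.
have sina : sin a = 0 by rewrite /a sinN sinpi oppr0.
have in_ab y : 0 <= y <= pi -> y \in `]a, b[.
  by move=> /andP[y0 y1]; rewrite in_itv /= bE /a; apply/andP; split; lra.
have in_ab' y : 0 <= y <= pi -> y \in `[a, b].
  by move=> /in_ab; exact: subset_itv_oo_cc.
pose S : V := Psi 0 a; pose e1 : V := vec 1 0 0.
have sS : sphere S by exact: sphere_Psi.
have te : tangent S e1 by rewrite /tangent /= dotE !vecE sina; ring.
pose s0 (i : 'I_n.+1) := if unlift ord0 i is Some k then contr n r (pairing S e1) k else 0.
have [s [sa cs dsy dsx csz]] := parallel_sections s0 a b ab sina.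
pose Z x y := \sum_k s x y (lift ord0 k) *: f k (Psi x y).
have tZ x y : tangent (Psi x y) (Z x y) by exact: tangent_comb.
have Psia x : Psi x a = S.
  by apply/rowP; apply: ord3P; rewrite !vecE ?sina ?mul0r.
have Z0 x y : y \in `[a, b] -> Z x y <> 0.
  move=> yab /(parallel_field_eq0 x (s x) a b (cs x) (fun y i => dsy x y i) y yab).
  rewrite Psia; under eq_bigr do rewrite sa /s0 liftK.
  rewrite contr_pairing // => /rowP/(_ i0); rewrite vecE mxE => /eqP.
  by rewrite oner_eq0.
have det0 x y u v : det3 (Psi x y) u (Z x y) = 0 -> det3 (Psi x y) v (Z x y) = 0 ->
    tangent (Psi x y) u -> tangent (Psi x y) v -> det3 (Psi x y) u v != 0 ->
    Z x y = 0.
  move=> h1 h2 tu tv h3.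
  apply/rowP => i; rewrite mxE; apply: (mulfI h3); rewrite mulr0.
  have h4 := det3_tangent _ _ _ _ (sP x y) tu tv (tZ x y).
  transitivity (v 0 i * det3 (Psi x y) u (Z x y) - u 0 i * det3 (Psi x y) v (Z x y)
     + Psi x y 0 i * det3 u v (Z x y)).
    by move: i; apply: ord3P; rewrite /det3; ring.
  by rewrite h1 h2 h4; ring.
have ey x y : y \in `]a, b[ -> is_derive y 1 (fun y => s x y ord0)
    (density w (Psi x y) * det3 (Psi x y) (Psiy x y) (Z x y)).
  by move=> /(dsy x y ord0) h; apply: (is_derive_eq h); rewrite /Q conn_row0 pairing_comb.
have ex x y : y \in `]a, b[ -> is_derive x 1 (fun x => s x y ord0)
    (density w (Psi x y) * det3 (Psi x y) (Psix x y) (Z x y)).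
  by move=> /(dsx x y ord0) h; apply: (is_derive_eq h); rewrite /P conn_row0 pairing_comb.
have perx x y i : y \in `[a, b] -> s (x + b) y i = s x y i.
  move=> yab; have PsiD y' : Psi (x + b) y' = Psi x y'.
    by rewrite /Psi /b cosD2pi sinD2pi.
  have PsiyD y' : Psiy (x + b) y' = Psiy x y'.
    by rewrite /Psiy /b cosD2pi sinD2pi.
  have cQ j k : {within `[a, b], continuous (fun y => Q x y j k)}.
    have c2 : cont2 (fun x y => Q x y j k).
      by apply: cont2_conn => l; apply: cont2_pairing; exact: cont2V_Psiy.
    exact: (continuous_subspaceT (continuous_slice2 _ x c2)).
  apply: (linear_ode_unique n.+1 (Q x) a b (s (x + b)) (s x) cQ (cs _) (cs _)) => //.
  - move=> y' j y'ab; have h := dsy (x + b) y' j y'ab.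
    by apply: (is_derive_eq h); rewrite /Q /bq PsiD PsiyD.
  - by move=> j; rewrite !sa.
have cK : compact (`[0, b] `*` `[0, pi] : set (R * R)).
  by apply: compact_setX; exact: segment_compact.
have K0 : (`[0, b] `*` `[0, pi] : set (R * R)) !=set0.
  by exists (0, 0); split; rewrite /= in_itv /= lexx /= ?bE; lra.
have cetaK : {within `[0, b] `*` `[0, pi], continuous (fun z : R * R => s z.1 z.2 ord0)}.
  apply: continuous_in_subspaceT => z; rewrite inE => -[_ /=].
  by rewrite in_itv /= => /in_ab; exact: csz.
have [[x0 y0] mK maxK] := compact_EVT_max K0 cK cetaK.
have [x0b y0pi] : 0 <= x0 <= b /\ 0 <= y0 <= pi.
  by move: mK; rewrite inE => -[/=]; rewrite !in_itv.
have max0 x y : 0 <= x <= b -> 0 <= y <= pi -> s x y ord0 <= s x0 y0 ord0.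
  by move=> hx hy; apply: (maxK (x, y)); rewrite inE; split; rewrite /= in_itv.
(* Periodicity makes the ends of [0, b] interior points. *)
have max1 x y : - b <= x <= b + b -> 0 <= y <= pi -> s x y ord0 <= s x0 y0 ord0.
  move=> /andP[x1 x2] hy; have yab := in_ab' y hy.
  have [xneg|xpos] := ltP x 0.
    by rewrite -perx //; apply: max0 => //; apply/andP; split; lra.
  have [xb|bx] := leP x b; first by apply: max0 => //; rewrite xpos xb.
  rewrite -[x](subrK b) perx //; apply: max0 => //; apply/andP; split; lra.
have y0ab := in_ab y0 y0pi.
have d0 := density_neq0 (Psi x0 y0) (sP x0 y0).
have [y0pole|y0pole] := eqVneq (sin y0) 0; last first.
  have y0in : y0 \in `]0, pi[.
    move: y0pi; rewrite in_itv /= !le_eqVlt => /andP[/orP[/eqP y00|->]].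
      by move: y0pole; rewrite -y00 sin0 eqxx.
    move=> /orP[/eqP y00|-> //].
    by move: y0pole; rewrite y00 sinpi eqxx.
  have cy : is_derive y0 1 (fun y => s x0 y ord0) 0.
    apply: (@derive1_at_max _ _ 0 pi) => //; first exact: ltW.
    - move=> t; rewrite in_itv /= => /andP[t0 t1].
      have tab : t \in `]a, b[ by apply: in_ab; rewrite !ltW.
      by have [] := ey x0 t tab.
    - move=> t; rewrite in_itv /= => /andP[t0 t1].
      by apply: max0 => //; rewrite !ltW.
  have cx : is_derive x0 1 (fun x => s x y0 ord0) 0.
    apply: (@derive1_at_max _ _ (- b) (b + b)) => //; first by rewrite bE; lra.
    - by move=> t _; have [] := ex t y0 y0ab.
    - by rewrite in_itv /=; apply/andP; move/andP: x0b => [h1 h2]; split; move: bE; lra.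
    - move=> t; rewrite in_itv /= => /andP[t0 t1].
      by apply: max1 => //; rewrite !ltW.
  have dy : density w (Psi x0 y0) * det3 (Psi x0 y0) (Psiy x0 y0) (Z x0 y0) = 0.
    by have [_ <-] := ey x0 y0 y0ab; have [_ ->] := cy.
  have dx : density w (Psi x0 y0) * det3 (Psi x0 y0) (Psix x0 y0) (Z x0 y0) = 0.
    by have [_ <-] := ex x0 y0 y0ab; have [_ ->] := cx.
  apply: (Z0 x0 y0); first exact: in_ab'.
  apply: (det0 x0 y0 (Psix x0 y0) (Psiy x0 y0)).
  - by apply: (mulfI d0); rewrite dx mulr0.
  - by apply: (mulfI d0); rewrite dy mulr0.
  - exact: tangent_Psix.
  - exact: tangent_Psiy.
  - rewrite (_ : det3 _ _ _ = - sin y0) ?oppr_eq0 // /det3 !vecE.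
    transitivity (- sin y0 * (cos x0 ^+ 2 + sin x0 ^+ 2) * (cos y0 ^+ 2 + sin y0 ^+ 2)).
      by ring.
    by rewrite !cos2Dsin2 !mulr1.
have sconst x i : s x y0 i = s x0 y0 i.
  have ds (z : R) : is_derive z 1 (fun x => s x y0 i) 0.
    apply: (is_derive_eq (dsx z y0 i y0ab)).
    by rewrite big1 // => j _; rewrite conn_pole // mul0r.
  have le0 z : `|z - x0| < `|x - x0| + 1 -> `|0 : R| <= 0 by rewrite normr0.
  have lt1 : `|x - x0| < `|x - x0| + 1 by rewrite ltrDl.
  have := mvt_norm (fun x => s x y0 i) (fun=> 0) 0 x0 _ ds le0 x lt1.
  by rewrite mul0r normr_le0 subr_eq0 => /eqP.
have Psiconst x : Psi x y0 = Psi 0 y0.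
  by apply/rowP; apply: ord3P; rewrite !vecE ?y0pole ?mul0r.
have Zconst x : Z x y0 = Z 0 y0.
  rewrite /Z Psiconst; apply: eq_bigr => k _.
  by rewrite (sconst x) (sconst 0).
pose D x := density w (Psi 0 y0) * det3 (Psi 0 y0) (Psiy x y0) (Z 0 y0).
(* sg points from the pole into the strip. *)
have [sg sg2 sgin] : exists2 sg : R, sg ^+ 2 = 1 &
    forall h, 0 < h < pi -> 0 <= y0 + sg * h <= pi.
  have [y00|y0n] := eqVneq y0 0.
    exists 1; first by rewrite expr1n.
    by move=> h /andP[h0 h1]; rewrite y00 mul1r add0r !ltW.
  have -> : y0 = pi.
    apply/eqP; apply: contraT => y0npi.
    suff : 0 < sin y0 by rewrite y0pole ltxx.
    apply: sin_gt0_pi; move: y0pi; rewrite !le_eqVlt (negPf y0npi).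
    by rewrite eq_sym (negPf y0n).
  exists (-1); first by rewrite sqrrN expr1n.
  by move=> h /andP[h0 h1]; rewrite mulN1r; apply/andP; split; lra.
have Dle x : 0 <= x <= b -> sg * D x <= 0.
  move=> xb; have := ey x y0 y0ab; rewrite Psiconst Zconst -/(D x) => h.
  apply: (derive_side_max _ _ _ _ _ h pi0) => k /sgin hk.
  by rewrite (sconst x); exact: max0.
have Dpi x : D (x + pi) = - D x.
  rewrite /D (_ : Psiy (x + pi) y0 = - Psiy x y0); first by rewrite /det3 !mxE; ring.
  have oppE (v : V) i : (- v) 0 i = - v 0 i by rewrite mxE.
  apply/rowP; apply: ord3P; rewrite oppE !vecE.
  - by rewrite cosDpi mulrN.
  - by rewrite sinDpi mulrN.
  - by rewrite y0pole !oppr0.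
have D0 x : 0 <= x <= pi -> D x = 0.
  move=> /andP[x1 x2].
  have h1 : sg * D x <= 0 by apply: Dle; rewrite x1 bE; lra.
  have h2 : sg * D (x + pi) <= 0 by apply: Dle; rewrite bE; apply/andP; split; lra.
  have h3 : sg * D x = 0 by rewrite Dpi in h2; lra.
  by rewrite -[D x]mul1r -sg2 expr2 -mulrA h3 mulr0.
apply: (Z0 0 y0); first exact: in_ab'.
have c2 : cos y0 ^+ 2 = 1 by have := cos2Dsin2 y0; rewrite y0pole expr0n addr0.
apply: (det0 0 y0 (Psiy 0 y0) (Psiy (pi / 2) y0)).
- have d00 := density_neq0 (Psi 0 y0) (sP 0 y0).
  by apply: (mulfI d00); rewrite mulr0; apply: D0; rewrite lexx ltW.
- have d00 := density_neq0 (Psi 0 y0) (sP 0 y0).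
  by apply: (mulfI d00); rewrite mulr0; apply: D0; apply/andP; split; lra.
- exact: tangent_Psiy.
- by rewrite -(Psiconst (pi / 2)); exact: tangent_Psiy.
- rewrite /det3 !vecE y0pole cos0 sin0 cos_pihalf sin_pihalf.
  rewrite (_ : _ + _ = cos y0 ^+ 2 * cos y0); last by ring.
  rewrite c2 mul1r; apply/eqP => c0; move: c2; rewrite c0 expr0n => /eqP.
  by rewrite eq_sym oner_eq0.
Qed.

End InducedPoisson.

Theorem proposition3p11 (R : realType)
    (w : 'rV[R]_3 -> 'rV[R]_3 -> 'rV[R]_3 -> R) (hw : symplectic_form w) :
  ~ exists (g : lie_algebra R) (phi : g -> 'rV[R]_3 -> 'rV[R]_3)
      (n : nat) (e : n.-tuple g) (r : 'M[R]_n),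
      [/\ basis_of fullv e,
          lie_action phi,
          r_matrix (tnth e) r
        & poisson_bivector_of w (induced_bivector phi (tnth e) r)].
Proof.
case=> g [phi [n [e [r [he hphi hr hpi]]]]].
exact: (symplectic_not_induced w hw g phi n e r he hphi hr hpi).
Qed.
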